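(* Let $\alpha>0$, $\lambda>0$, $\varepsilon>0$, $N$ a positive integer and $\kappa\in\mathbb R$. Assume there exists a power spectral density $\bar\Phi$ (an integrable function on $\mathbb T$ with values in the $m\times m$ Hermitian positive semidefinite matrices) which is positive definite on some open interval of $\mathbb T$ and satisfies $\int_{\mathbb T}\bar\Phi e^{i\theta k}=R_k$ for $k=0,\dots,n$. Then the problem $$\min_{(\mathbf p,\mathbf Q,\bm\gamma)\in\mathcal C}\ \tilde\ell(\mathbf p,\mathbf Q,\alpha,\bm\gamma),\qquad \mathcal C=\{(\mathbf p,\mathbf Q,\bm\gamma):\ \mathbf p\in\overline{\mathfrak B_+^o},\ \mathbf Q\in\overline{\mathfrak B_+^m},\ \gamma_{jh}>0\ \text{for all } j\ge h\},$$ admits a solution, and every such solution satisfies $(\mathbf p,\mathbf Q)\in\mathfrak B_+^o\times\mathfrak B_+^m$.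
   Context: Let $m,n$ be positive integers and $V=\{1,\dots,m\}$. Let $\mathbb T=[0,2\pi)$ and write $\int_{\mathbb T}f$ for $\int_0^{2\pi}f(\theta)\,\frac{d\theta}{2\pi}$. $\mathfrak B_+^m$ is the set of matrix trigonometric polynomials $\mathbf Q(e^{i\theta})=Q_0+\frac12\sum_{k=1}^n\big(Q_ke^{-i\theta k}+Q_k^Te^{i\theta k}\big)$ with $Q_0\in\mathbb R^{m\times m}$ symmetric, $Q_1,\dots,Q_n\in\mathbb R^{m\times m}$ arbitrary, and $\mathbf Q(e^{i\theta})$ positive definite for every $\theta\in\mathbb T$. $\overline{\mathfrak B_+^m}$ denotes the closure of $\mathfrak B_+^m$ (in the finite-dimensional coefficient space) from which the points $\mathbf Q$ with $\det\mathbf Q(e^{i\theta})=0$ for all $\theta\in\mathbb T$ are removed. $\mathfrak B_+^o$ is the set of scalar trigonometric polynomials $\mathbf p(e^{i\theta})=1+\frac12\sum_{k=1}^n p_k(e^{-i\theta k}+e^{i\theta k})$, $p_k\in\mathbb R$, with $\mathbf p(e^{i\theta})>0$ for all $\theta$; $\overline{\mathfrak B_+^o}$ is its closure. Set $p_0=1$. Data: real $m\times m$ matrices $R_0,\dots,R_n$ ($R_0$ symmetric) and real numbers $c_0,\dots,c_n$. Define (values in $\mathbb R\cup\{+\infty\}$) $$J(\mathbf p,\mathbf Q)=\int_{\mathbb T}\Big(\mathbf p\log\det(\mathbf p\mathbf Q^{-1})-m\mathbf p\Big)+\sum_{k=0}^n\mathrm{tr}(Q_k^TR_k)-\sum_{k=0}^np_kc_k,$$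 $g_\lambda(\mathbf p)=\lambda\int_{\mathbb T}\mathbf p^{-1}$. The hyperparameter vector $\bm\gamma$ has entries $\gamma_{jh}$, $1\le h\le j\le m$. Let $q_{jh}(\mathbf Q)=\max\{|[Q_0]_{jh}|,\max_{k=1,\dots,n}|[Q_k]_{jh}|,\max_{k=1,\dots,n}|[Q_k]_{hj}|\}$ and $h_W(\mathbf Q)=\sum_{j\ge h}\gamma_{jh}q_{jh}(\mathbf Q)$. Define $$\tilde\ell(\mathbf p,\mathbf Q,\alpha,\bm\gamma)=\frac{N}{2\alpha}J(\mathbf p,\mathbf Q)+\kappa+g_\lambda(\mathbf p)+h_W(\mathbf Q)-\sum_{j>h}(2n+1)\log\gamma_{jh}-\sum_{j=1}^m(n+1)\log\gamma_{jj}+\sum_{j\ge h}\varepsilon\gamma_{jh}.$$ *)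

(* Defs.v *)
From HB Require Import structures.
From mathcomp Require Import all_boot all_order all_algebra.
From mathcomp Require Import all_classical all_reals all_analysis.
From mathcomp Require Import complex.
Import Order.TTheory GRing.Theory Num.Theory.
Import numFieldNormedType.Exports.

Set Implicit Arguments.
Unset Strict Implicit.
Unset Printing Implicit Defensive.

Local Open Scope classical_set_scope.
Local Open Scope ring_scope.

Definition Tset (R : realType) : set R := `[0%R, (2 * pi)%R[%classic.

Definition intT (R : realType) (f : R -> \bar R) : \bar R :=
  (((2 * pi)^-1)%:E * \int[@lebesgue_measure R]_(t in @Tset R) f t)%E.

Definition expi (R : realType) (x : R) : R[i] := (cos x +i* sin x)%C.

Definition ctr (R : realType) (m : nat) (x : 'cV[R[i]]_m) : 'rV[R[i]]_m :=
  \row_j (x j 0)^*.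

(* Hermitian positive semidefinite / positive definite complex matrices.
   (In the partial order of R[i], 0 <= z means z is real and nonnegative.) *)
Definition hermitian (R : realType) (m : nat) (M : 'M[R[i]]_m) : Prop :=
  forall a b, M a b = (M b a)^*.
Definition psd (R : realType) (m : nat) (M : 'M[R[i]]_m) : Prop :=
  hermitian M /\ forall x : 'cV[R[i]]_m, 0 <= (ctr x *m M *m x) 0 0.
Definition posdef (R : realType) (m : nat) (M : 'M[R[i]]_m) : Prop :=
  hermitian M /\ forall x : 'cV[R[i]]_m, x != 0 -> 0 < (ctr x *m M *m x) 0 0.

Definition cmx (R : realType) (m : nat) (A : 'M[R]_m) : 'M[R[i]]_m :=
  map_mx (fun r : R => (r +i* 0)%C) A.

(* Scalar trig polynomial p(e^{i theta}) = p_0 + 1/2 sum_{k=1}^n p_k (e^{-ik theta}+e^{ik theta})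
   = p_0 + sum_k p_k cos(k theta), coefficients p : nat -> R (only 0..n used). *)
Definition peval (R : realType) (n : nat) (p : nat -> R) (t : R) : R :=
  p 0%N + \sum_(1 <= k < n.+1) p k * cos (k%:R * t).

Definition Qeval (R : realType) (m n : nat) (Q : nat -> 'M[R]_m) (t : R) : 'M[R[i]]_m :=
  cmx (Q 0%N) + (2^-1 : R[i]) *:
    \sum_(1 <= k < n.+1) (expi (- (k%:R * t)) *: cmx (Q k) + expi (k%:R * t) *: cmx (Q k)^T).

Definition Bo (R : realType) (n : nat) (p : nat -> R) : Prop :=
  p 0%N = 1 /\ forall t : R, 0 < peval n p t.

Definition Bm (R : realType) (m n : nat) (Q : nat -> 'M[R]_m) : Prop :=
  (Q 0%N)^T = Q 0%N /\ forall t : R, posdef (Qeval n Q t).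

(* closure of B_+^o in the (finite-dimensional) coefficient space (p_0..p_n),
   written as sequential closure *)
Definition Bo_closure (R : realType) (n : nat) (p : nat -> R) : Prop :=
  exists s : nat -> nat -> R, (forall j, Bo n (s j)) /\
    forall k, (k <= n)%N -> (fun j => s j k) @ \oo --> p k.

Definition Bm_closure (R : realType) (m n : nat) (Q : nat -> 'M[R]_m) : Prop :=
  (exists s : nat -> nat -> 'M[R]_m, (forall j, Bm n (s j)) /\
    forall k, (k <= n)%N -> forall a b, (fun j => s j k a b) @ \oo --> Q k a b)
  /\ ~ (forall t : R, \det (Qeval n Q t) = 0).

Definition Jfun (R : realType) (m n : nat) (Rk : nat -> 'M[R]_m) (c : nat -> R)
    (p : nat -> R) (Q : nat -> 'M[R]_m) : \bar R :=
  (intT (fun t => (peval n p t * ln (complex.Re (\det ((peval n p t +i* 0)%C *: invmx (Qeval n Q t))))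
                   - m%:R * peval n p t)%:E)
   + (\sum_(0 <= k < n.+1) \tr ((Q k)^T *m Rk k))%:E
   - (\sum_(0 <= k < n.+1) p k * c k)%:E)%E.

Definition gfun (R : realType) (n : nat) (lam : R) (p : nat -> R) : \bar R :=
  (lam%:E * intT (fun t => ((peval n p t)^-1)%:E))%E.

Definition qjh (R : realType) (m n : nat) (Q : nat -> 'M[R]_m) (j h : 'I_m) : R :=
  Num.max `|Q 0%N j h|
    (\big[Num.max/0]_(1 <= k < n.+1) Num.max `|Q k j h| `|Q k h j|).

Definition hW (R : realType) (m n : nat) (gam : 'I_m -> 'I_m -> R)
    (Q : nat -> 'M[R]_m) : R :=
  \sum_(j < m) \sum_(h < m | (h <= j)%N) gam j h * qjh n Q j h.

Definition ell (R : realType) (m n N : nat) (Rk : nat -> 'M[R]_m) (c : nat -> R)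
    (kappa lam eps : R) (p : nat -> R) (Q : nat -> 'M[R]_m) (alpha : R)
    (gam : 'I_m -> 'I_m -> R) : \bar R :=
  ((N%:R / (2 * alpha))%:E * Jfun n Rk c p Q + kappa%:E + gfun n lam p
   + (hW n gam Q
      - \sum_(j < m) \sum_(h < m | (h < j)%N) (2 * n + 1)%:R * ln (gam j h)
      - \sum_(j < m) (n + 1)%:R * ln (gam j j)
      + \sum_(j < m) \sum_(h < m | (h <= j)%N) eps * gam j h)%:E)%E.

Definition feasible (R : realType) (m n : nat) (p : nat -> R) (Q : nat -> 'M[R]_m)
    (gam : 'I_m -> 'I_m -> R) : Prop :=
  Bo_closure n p /\ Bm_closure n Q /\ forall j h : 'I_m, (h <= j)%N -> 0 < gam j h.

Definition admissible_psd (R : realType) (m n : nat) (Rk : nat -> 'M[R]_m)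
    (Phi : R -> 'M[R[i]]_m) : Prop :=
  (forall a b, (@lebesgue_measure R).-integrable (@Tset R) (fun t => (complex.Re (Phi t a b))%:E)
            /\ (@lebesgue_measure R).-integrable (@Tset R) (fun t => (complex.Im (Phi t a b))%:E))
  /\ (forall t, @Tset R t -> psd (Phi t))
  /\ (exists a b : R, 0 <= a /\ a < b /\ b <= 2 * pi /\
        forall t, a < t < b -> posdef (Phi t))
  /\ (forall k, (k <= n)%N -> forall a b,
        intT (fun t => (complex.Re (Phi t a b * expi (k%:R * t)))%:E) = (Rk k a b)%:E
        /\ intT (fun t => (complex.Im (Phi t a b * expi (k%:R * t)))%:E) = 0%E).

(* Main.v *)
(** The hyperparameters are eliminated first: for fixed [Q] the best [gam j h] is
[weight j h / (q_jh + eps)], which leaves a continuous, bounded below penalty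
in [Q].  The sum of the [tr (Q_k^T R_k)] equals the integral of [tr (Q Phi)] divided
by [2 pi]; it is positive for every nonzero nonnegative [Q] because [Phi] is positive
definite on an interval, so by compactness it dominates a multiple of the coefficient
norm of [Q].  As [ln det Q] grows only logarithmically and the coefficients of [p] are
bounded by 2, sublevel sets are bounded.  A subsequence of a minimizing sequence of
interior points converges, and Fatou's lemma bounds the objective at its limit; it also
shows that [det Q] does not vanish identically there.
A zero of [p] or of a quadratic form of [Q] is at least quadratic.  Hence the integral of
[1/p] is infinite if [p] vanishes somewhere, while replacing a singular [Q] by [Q + s I]
lowers the integral of [- p ln det Q] by at least a multiple of [sqrt s], and raises all
the other terms by at most a multiple of [s]: boundary points are never optimal. *)

Require Import Defs.
From HB Require Import structures.
From mathcomp Require Import all_boot all_order all_algebra.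
From mathcomp Require Import all_classical all_reals all_analysis.
From mathcomp Require Import complex.
From mathcomp Require Import measurable_realfun ring lra zify.
Import Order.TTheory GRing.Theory Num.Theory.
Import numFieldNormedType.Exports.
Local Open Scope classical_set_scope.
Local Open Scope ring_scope.

Set Implicit Arguments.
Unset Strict Implicit.
Unset Printing Implicit Defensive.

(** * Positive semidefinite Hermitian matrices *)

(** The infimum is taken over interior pairs only, where both integrals are finite. Closure points
    enter by comparison: a boundary [p] has value +oo and a boundary [Q] is strictly beaten by an
    interior shift, so continuity of the objective up to the boundary never has to be established.
    Positivity of [p] is settled before that of [Q], because the gain in the logarithmic term
    carries the factor [p]. The origin of [sqrt s]: if [x] is a null vector of [Q] at [t0], its
    quadratic form is at most [K (t - t0)^2]. For [t - t0] up to [sqrt s], the ratio of [s |x|^2] to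
    this form is at least [|x|^2 / K], whatever [s] is. So [ln det] gains a fixed amount on an
    interval of length [sqrt s]. Where [det Q = 0] and [p > 0], the formal integrand has a finite
    default value although the intended one is +oo. This is harmless because such angles are finite
    in number: up to a power of [e^(it)], the determinant is a polynomial in [e^(it)]. *)

Lemma hermitian_diagonalization (C : numClosedFieldType) (m : nat) (M : 'M[C]_m) :
  M = map_mx Num.conj M^T ->
  exists (U : 'M[C]_m) (D : 'rV[C]_m),
    [/\ U *m map_mx Num.conj U^T = 1%:M,
        M = map_mx Num.conj U^T *m diag_mx D *m U
      & forall i, D 0 i \is Num.real].
Proof.
move=> hM.
have hs : M \is hermsymmx.
  by apply/is_hermitianmxP; rewrite expr0 scale1r.
have rd := hermitian_spectral_diag_real hs.
have Uu := spectral_unitarymx M.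
have /orthomx_spectralP ME := hermitian_normalmx hs.
exists (spectralmx M), (spectral_diag M); split.
- exact/unitarymxP.
- by rewrite -invmx_unitary.
- by move=> i; have /mxOverP /(_ 0 i) := rd.
Qed.

Section spectral.
Variable R : realType.
Local Notation C := R[i].
Local Notation rC := (real_complex R).
Variable m : nat.
Implicit Types (M : 'M[C]_m) (x : 'cV[C]_m).

Lemma qfE M x : (ctr x *m M *m x) 0 0
  = \sum_a \sum_b (x a 0)^* * M a b * x b 0.
Proof.
rewrite mxE exchange_big /=; apply: eq_bigr => b _.
rewrite mxE big_distrl /=; apply: eq_bigr => a _.
by rewrite mxE.
Qed.

Lemma ReD (y z : C) : complex.Re (y + z) = complex.Re y + complex.Re z.
Proof. by case: y; case: z. Qed.

Lemma Re_sum (I : Type) (r : seq I) (P : pred I) (F : I -> C) :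
  complex.Re (\sum_(i <- r | P i) F i) = \sum_(i <- r | P i) complex.Re (F i).
Proof. exact: (big_morph _ ReD). Qed.

(** The determinant is recorded for all shifts at once, so that [det M] and [det (M + s)] can be
    compared through the same eigenvalues. *)
Lemma hermitian_spectral M : Defs.hermitian M ->
  exists (U : 'M[C]_m) (d : 'I_m -> R),
    [/\ U *m map_mx Num.conj U^T = 1%:M,
        M = map_mx Num.conj U^T *m diag_mx (\row_i rC (d i)) *m U
      & forall s : R, \det (M + (rC s)%:M) = rC (\prod_i (d i + s))].
Proof.
move=> hM.
have [|U [D [UU ME rD]]] := @hermitian_diagonalization _ _ M.
  by apply/matrixP => a b; rewrite !mxE hM.
have UU' : map_mx Num.conj U^T *m U = 1%:M by exact: mulmx1C.
have dE : D = \row_i rC (complex.Re (D 0 i)).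
  by apply/rowP => i; rewrite mxE RRe_real// rD.
exists U, (fun i => complex.Re (D 0 i)); split; first exact: UU.
  by rewrite -dE; exact: ME.
move=> s.
have -> : (rC s)%:M = map_mx Num.conj U^T *m (rC s)%:M *m U :> 'M[C]_m.
  by rewrite -mulmxA -scalar_mxC mulmxA UU' mul1mx.
rewrite {1}ME -mulmxDl -mulmxDr !det_mulmx mulrC mulrA -det_mulmx UU.
rewrite det1 mul1r dE -diag_const_mx -linearD /= det_diag rmorph_prod.
by apply: eq_bigr => i _; rewrite !mxE rmorphD.
Qed.

Lemma ctr_map x : ctr x = map_mx Num.conj x^T.
Proof. by apply/rowP => j; rewrite !mxE. Qed.

Lemma conj_mulE (z : C) : z^* * z = rC (complex.Re z ^+ 2 + complex.Im z ^+ 2).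
Proof.
by case: z => a b; apply/eqP; rewrite eq_complex /= -!expr2; apply/andP; split;
  apply/eqP; ring.
Qed.

Lemma qf_diag (U : 'M[C]_m) (d : 'I_m -> R) x :
  (ctr x *m (map_mx Num.conj U^T *m diag_mx (\row_i rC (d i)) *m U) *m x) 0 0
  = rC (\sum_i d i * (complex.Re ((U *m x) i 0) ^+ 2
                      + complex.Im ((U *m x) i 0) ^+ 2)).
Proof.
have -> : ctr x *m (map_mx Num.conj U^T *m diag_mx (\row_i rC (d i)) *m U) *m x
   = ctr (U *m x) *m diag_mx (\row_i rC (d i)) *m (U *m x).
  by rewrite !ctr_map trmx_mul map_mxM !mulmxA.
rewrite mxE rmorph_sum; apply: eq_bigr => i _.
rewrite mul_mx_diag !mxE rmorphM /= -conj_mulE.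
by rewrite [_^* * rC _]mulrC mulrA.
Qed.

(** The squared Euclidean norm, with values in [R] so that it can enter real logarithms. *)
Definition sqn x : R := \sum_i (complex.Re (x i 0) ^+ 2 + complex.Im (x i 0) ^+ 2).

Lemma sqn_ge0 x : 0 <= sqn x.
Proof. by apply: sumr_ge0 => i _; rewrite addr_ge0// sqr_ge0. Qed.

Lemma sqn_gt0 x : x != 0 -> 0 < sqn x.
Proof.
move=> x0; rewrite lt_neqAle sqn_ge0 andbT eq_sym.
apply: contraNneq x0 => /eqP; rewrite psumr_eq0; last first.
  by move=> i _; rewrite addr_ge0// sqr_ge0.
move=> /allP h; apply/eqP/colP => i; rewrite mxE.
have := h i; rewrite mem_index_enum => /(_ isT).
rewrite paddr_eq0 ?sqr_ge0// !sqrf_eq0 => /andP[/eqP a /eqP b].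
by apply/eqP; rewrite eq_complex a b !eqxx.
Qed.

Lemma sqnE x : rC (sqn x) = (ctr x *m x) 0 0.
Proof.
rewrite mxE rmorph_sum; apply: eq_bigr => i _.
by rewrite mxE; exact/esym/conj_mulE.
Qed.

Lemma sqn_unitary (U : 'M[C]_m) x : map_mx Num.conj U^T *m U = 1%:M ->
  sqn (U *m x) = sqn x.
Proof.
move=> UU; apply: (@complexI R); rewrite !sqnE !ctr_map trmx_mul map_mxM.
by rewrite -mulmxA [map_mx Num.conj U^T *m _]mulmxA UU mul1mx.
Qed.

(* The eigenvalues are values of the quadratic form at the columns of U^* *)
Lemma mulmx_col (A B : 'M[C]_m) i : A *m col i B = col i (A *m B).
Proof. by rewrite !colE mulmxA. Qed.

Lemma psd_spectral M : psd M ->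
  exists (U : 'M[C]_m) (d : 'I_m -> R),
    [/\ U *m map_mx Num.conj U^T = 1%:M,
        M = map_mx Num.conj U^T *m diag_mx (\row_i rC (d i)) *m U,
        forall s : R, \det (M + (rC s)%:M) = rC (\prod_i (d i + s)),
        forall i, 0 <= d i
      & posdef M -> forall i, 0 < d i].
Proof.
move=> [hM qM]; have [U [d [UU ME dM]]] := hermitian_spectral hM.
have UU' : map_mx Num.conj U^T *m U = 1%:M by exact: mulmx1C.
have qd i : (ctr (col i (map_mx Num.conj U^T)) *m M *m col i (map_mx Num.conj U^T)) 0 0 = rC (d i).
  rewrite ME qf_diag; congr (rC _).
  rewrite (bigD1 i)//= big1 ?addr0.
    by rewrite mulmx_col UU !mxE eqxx /= expr1n expr0n /= addr0 mulr1.
  move=> k ki; rewrite mulmx_col UU !mxE (negbTE ki) /=.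
  by rewrite expr0n /= addr0 mulr0.
exists U, d; split => //.
- by move=> i; have := qM (col i (map_mx Num.conj U^T)); rewrite qd ler0c.
- move=> [_ pM] i; have := pM (col i (map_mx Num.conj U^T)).
  rewrite qd ltcR; apply; apply/negP => /eqP c0.
  have := congr1 (fun A => (U *m A) i 0) c0.
  by rewrite mulmx_col UU mulmx0 !mxE eqxx => /eqP; rewrite oner_eq0.
Qed.

Lemma posdef_psd M : posdef M -> psd M.
Proof.
move=> [hM pM]; split=> // x; have [->|/pM/ltW//] := eqVneq x 0.
by rewrite mulmx0 mxE.
Qed.

Lemma posdef_det M : posdef M -> 0 < \det M.
Proof.
move=> pM; have [U [d [_ _ dM _ /(_ pM) d0]]] := psd_spectral (posdef_psd pM).
have := dM 0; rewrite raddf0 addr0 => ->.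
by rewrite ltcR; apply: prodr_gt0 => i _; rewrite addr0.
Qed.

Lemma psd_det M : psd M -> 0 <= \det M.
Proof.
move=> pM; have [U [d [_ _ dM d0 _]]] := psd_spectral pM.
have := dM 0; rewrite raddf0 addr0 => ->.
by rewrite ler0c; apply: prodr_ge0 => i _; rewrite addr0.
Qed.

Lemma psd_shift M (s : R) : psd M -> 0 < s -> posdef (M + (rC s)%:M).
Proof.
move=> [hM pM] s0; split.
  move=> a b; rewrite !mxE rmorphD /= hM eq_sym; congr (_ + _).
  by case: (b == a); rewrite ?mulr1n ?mulr0n ?rmorph0//; exact/esym/conjc_real.
move=> x x0; rewrite mulmxDr mulmxDl mxE.
apply: ltr_wpDl; first exact: pM.
by rewrite mul_mx_scalar -scalemxAl mxE -sqnE -rmorphM ltcR mulr_gt0// sqn_gt0.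
Qed.

(* det (M + s) / det M = prod (1 + s / d_i) with d_min <= <Mx, x> / |x|^2 *)
Lemma det_shift_ge M (s : R) x : psd M -> 0 < \det M -> 0 < s -> x != 0 ->
  0 < complex.Re ((ctr x *m M *m x) 0 0) /\
  complex.Re (\det M) * (1 + s * sqn x / complex.Re ((ctr x *m M *m x) 0 0))
  <= complex.Re (\det (M + (rC s)%:M)).
Proof.
move=> pM dM0 s0 x0; have [U [d [UU ME dM d0 _]]] := psd_spectral pM.
have UU' : map_mx Num.conj U^T *m U = 1%:M by exact: mulmx1C.
have dM' : \det M = rC (\prod_i d i).
  have := dM 0; rewrite raddf0 addr0 => ->; congr (rC _).
  by apply: eq_bigr => i _; rewrite addr0.
have dp i : 0 < d i.
  rewrite lt_neqAle d0 andbT eq_sym; apply/negP => /eqP di.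
  by move: dM0; rewrite dM' ltcR (bigD1 i)//= di mul0r ltxx.
have q0 := sqn_gt0 x0.
set w := fun i => complex.Re ((U *m x) i 0) ^+ 2 + complex.Im ((U *m x) i 0) ^+ 2.
have w0 i : 0 <= w i by rewrite addr_ge0// sqr_ge0.
have wS : \sum_i w i = sqn x by rewrite -(sqn_unitary x UU').
rewrite dM dM' {1 2}ME qf_diag /= -/w.
set q := \sum_i d i * w i.
(* The smallest eigenvalue has this property. An index with [w j > 0] is extracted first, since
   taking a minimum requires an inhabitant of ['I_m]. *)
have [i di] : exists i, d i * sqn x <= q.
  apply/not_existsP => H.
  have [j wj] : exists j, 0 < w j.
    apply/not_existsP => H'; move: q0; rewrite -wS big1 ?ltxx// => j _.
    apply/eqP; rewrite eq_le w0 andbT leNgt; apply/negP; exact: H'.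
  have [k kP kmin] : exists2 k, true & forall l, d k <= d l.
    by case: (@arg_minP _ _ _ j predT d isT) => k _ h; exists k => // l; exact: h.
  apply: (H k); rewrite -wS mulr_sumr; apply: ler_sum => l _.
  by rewrite ler_wpM2r// kmin.
have qp : 0 < q by apply: lt_le_trans di; rewrite mulr_gt0.
split => //.
(* Only the factor of index [i] is enlarged quantitatively, using [d i * sqn x <= q]; for the others
   [d k <= d k + s] is enough. *)
rewrite (bigD1 i)//= [leRHS](bigD1 i)//= [X in X <= _]mulrAC.
apply: ler_pM.
- by apply: mulr_ge0 => //; rewrite addr_ge0// divr_ge0// ?mulr_ge0// ltW.
- by apply: prodr_ge0 => k _; exact: d0.
- rewrite mulrDr mulr1 lerD2l.
  have -> : d i * (s * sqn x / q) = s * (d i * sqn x / q) by ring.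
  by rewrite ler_piMr ?(ltW s0)// ler_pdivrMr// mul1r.
- by apply: ler_prod => k _; rewrite d0/= lerDl ltW.
Qed.

(** The eigenvalues are nonnegative, so each is at most the trace. The crude power suffices because
    only its logarithm matters. *)
Lemma psd_det_le M : psd M -> complex.Re (\det M) <= (\sum_i complex.Re (M i i)) ^+ m.
Proof.
move=> pM; have [U [d [UU ME dM d0 _]]] := psd_spectral pM.
have UU' : map_mx Num.conj U^T *m U = 1%:M by exact: mulmx1C.
have dM' : \det M = rC (\prod_i d i).
  have := dM 0; rewrite raddf0 addr0 => ->; congr (rC _).
  by apply: eq_bigr => i _; rewrite addr0.
have trE : \tr M = rC (\sum_i d i).
  rewrite ME mxtrace_mulC mulmxA UU mul1mx mxtrace_diag rmorph_sum.
  by apply: eq_bigr => i _; rewrite mxE.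
have -> : \sum_i complex.Re (M i i) = \sum_i d i.
  have := congr1 (@complex.Re R) trE; rewrite /= => <-.
  by rewrite Re_sum.
rewrite dM' /= -[X in _ ^+ X]card_ord -prodr_const; apply: ler_prod => i _.
by rewrite d0 /= (bigD1 i)//= lerDl sumr_ge0.
Qed.


(** The left side is the trace of [M^* P]. Writing [M] as the sum of [d_i u_i u_i^*] over the
    columns [u_i] of [U^*] leaves the quadratic form of [P] at each eigenvector, so signs can be
    read off termwise. *)
Lemma pairing_spectral (P : 'M[C]_m) (U : 'M[C]_m) (d : 'I_m -> R) :
  \sum_a \sum_b ((map_mx Num.conj U^T *m diag_mx (\row_i rC (d i)) *m U) a b)^* * P a b
  = \sum_i rC (d i) *
      (ctr (col i (map_mx Num.conj U^T)) *m P *m col i (map_mx Num.conj U^T)) 0 0.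
Proof.
under [RHS]eq_bigr => i _ do rewrite qfE mulr_sumr.
rewrite [RHS]exchange_big /=; apply: eq_bigr => a _.
under [RHS]eq_bigr => i _ do rewrite mulr_sumr.
rewrite [RHS]exchange_big /=; apply: eq_bigr => b _.
rewrite mxE rmorph_sum mulr_suml; apply: eq_bigr => i _.
rewrite mul_mx_diag !mxE !rmorphM /= conjCK.
have -> : (rC (d i))^* = rC (d i) by exact: conjc_real.
by ring.
Qed.

Lemma psd_pairing M (P : 'M[C]_m) : psd M -> psd P ->
  0 <= \sum_a \sum_b (M a b)^* * P a b.
Proof.
move=> pM [_ pP]; have [U [d [_ ME _ d0 _]]] := psd_spectral pM.
rewrite ME pairing_spectral; apply: sumr_ge0 => i _.
by apply: mulr_ge0 => //; rewrite ler0c.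
Qed.

Lemma posdef_pairing M (P : 'M[C]_m) : psd M -> posdef P -> M != 0 ->
  0 < \sum_a \sum_b (M a b)^* * P a b.
Proof.
move=> pM [_ pP] M0; have [U [d [UU ME _ d0 _]]] := psd_spectral pM.
have c0 i : col i (map_mx Num.conj U^T) != 0.
  apply/negP => /eqP c0; have := congr1 (fun A => (U *m A) i 0) c0.
  by rewrite mulmx_col UU mulmx0 !mxE eqxx => /eqP; rewrite oner_eq0.
rewrite ME pairing_spectral.
have [i di] : exists i, d i != 0.
  apply/existsP; apply: contraNT M0; rewrite negb_exists => /forallP d00.
  have -> : M = 0; last by [].
  rewrite ME [X in diag_mx X](_ : _ = 0) ?linear0 ?mulmx0 ?mul0mx//.
  by apply/rowP => i; rewrite !mxE; have := d00 i; rewrite negbK => /eqP ->.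
rewrite (bigD1 i)//=; apply: ltr_pwDl.
  by rewrite mulr_gt0 ?pP// ltcR lt_neqAle eq_sym di d0.
by apply: sumr_ge0 => k _; rewrite mulr_ge0 ?ler0c// ltW// pP.
Qed.

End spectral.

(** * Trigonometric polynomials *)

Section trig.
Variable R : realType.
Local Notation C := R[i].
Local Notation rC := (real_complex R).
Implicit Types t x : R.

Lemma expiD x y : expi (x + y) = expi x * expi y.
Proof.
rewrite /expi cosD sinD; apply/eqP; rewrite eq_complex /=.
by apply/andP; split; apply/eqP; ring.
Qed.

Lemma expi0 : expi (0 : R) = 1.
Proof. by rewrite /expi cos0 sin0. Qed.

Lemma expi_natM (k : nat) t : expi (k%:R * t) = expi t ^+ k.
Proof.
elim: k => [|k ih]; first by rewrite mul0r expi0 expr0.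
by rewrite -addn1 natrD mulrDl mul1r expiD ih addn1 exprSr.
Qed.

Lemma expi_mulN t : expi t * expi (- t) = 1.
Proof. by rewrite -expiD subrr expi0. Qed.

Lemma expi_neq0 t : expi t != 0.
Proof.
apply/negP => /eqP h; have := expi_mulN t.
by rewrite h mul0r => /esym/eqP; rewrite oner_eq0.
Qed.

Lemma conj_expi t : (expi t)^* = expi (- t).
Proof. by rewrite /expi cosN sinN. Qed.

(** Positivity is required at all real angles while integrals run over one period; a zero found
    anywhere is moved into [Tset] by subtracting whole turns. *)
Lemma expi_representative t : exists2 t', Tset t' & expi t' = expi t.
Proof.
have p2 : 0 < 2 * pi :> R by rewrite mulr_gt0// pi_gt0.
have per (k : nat) x : expi (x + k%:R * (2 * pi)) = expi x.
  by rewrite (mulr_natl pi 2) expiD expi_natM /expi cos2pi sin2pi [X in X ^+ _](_ : _ = 1)// expr1n mulr1.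
have perz (z : int) x : expi (x + z%:~R * (2 * pi)) = expi x.
  case: z => k; first exact: per.
  by rewrite -(per k.+1) NegzE mulrNz mulNr subrK.
pose z := Num.floor (t / (2 * pi)).
exists (t - z%:~R * (2 * pi)); last by rewrite -{2}(subrK (z%:~R * (2 * pi)) t) perz.
rewrite /Tset /= in_itv /= subr_ge0 ltrBlDr -ler_pdivlMr// floor_le_tmp/=.
have := floorD1_gt (t / (2 * pi)); rewrite -/z ltr_pdivrMr// => /lt_le_trans; apply.
by rewrite intrD mulrDl mul1r addrC.
Qed.

(** Within a period, [cos t] determines [t] up to the reflection [t -> 2 pi - t]. *)
Lemma finite_expi_preimage (r : seq C) : finite_set [set t | Tset t /\ expi t \in r].
Proof.
pose F (z : C) := acos (complex.Re z).
apply: (@sub_finite_set _ _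
  ((F @` [set` r]) `|` ((fun z => 2 * pi - F z) @` [set` r]))); last first.
  by rewrite finite_setU; split; apply: finite_image; exact: finite_seq.
move=> t [+ tr]; rewrite /Tset /= in_itv /= => /andP[t0 t2].
have [tp|pt] := leP t pi.
  by left; exists (expi t) => //; rewrite /F /= cosK// in_itv /= t0.
right; exists (expi t) => //; rewrite /F /=.
have -> : cos t = cos (2 * pi - t).
  by rewrite -[2 * pi - t]opprB cosN mulr_natl -[in LHS](subrK (pi *+ 2) t) cosD2pi.
rewrite cosK; first by rewrite opprB addrC subrK.
by rewrite in_itv /= subr_ge0 (ltW t2) /= lerBlDr; lra.
Qed.

Lemma finite_root_expi (P : {poly C}) : P != 0 ->
  finite_set [set t | Tset t /\ P.[expi t] = 0].
Proof.
move=> P0; have [r Pr] := closed_field_poly_normal P.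
apply: sub_finite_set (finite_expi_preimage r) => t /= [Tt Pt]; split=> //.
rewrite -root_prod_XsubC -[X in root X _](scale1r) -(@rootZ _ _ (lead_coef P)).
  by rewrite scale1r -Pr; apply/eqP.
by rewrite lead_coef_eq0.
Qed.
End trig.

(** * Zeros of matrix trigonometric polynomials *)

Section Qpoly.
Variable R : realType.
Local Notation C := R[i].
Local Notation rC := (real_complex R).
Variables m n : nat.
Implicit Types (Q : nat -> 'M[R]_m).

Lemma QevalE Q t a b : Qeval n Q t a b = rC (Q 0%N a b) +
  2^-1 * \sum_(1 <= k < n.+1) (expi (- (k%:R * t)) * rC (Q k a b)
                               + expi (k%:R * t) * rC (Q k b a)).
Proof.
by rewrite !mxE summxE; congr (_ + _ * _); apply: eq_bigr => k _; rewrite !mxE.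
Qed.

(* [z ^ n * Q(z)], a polynomial in [z = e^(i t)]. *)
Definition Qpoly Q : 'M[{poly C}]_m := \matrix_(a, b)
  ((rC (Q 0%N a b))%:P * 'X^n + (2^-1)%:P * \sum_(1 <= k < n.+1)
    ((rC (Q k a b))%:P * 'X^(n - k) + (rC (Q k b a))%:P * 'X^(n + k))).

Lemma horner_Qpoly Q t a b :
  (Qpoly Q a b).[expi t] = expi t ^+ n * Qeval n Q t a b.
Proof.
rewrite QevalE mxE !hornerE mulrDr mulrC; congr (_ + _).
rewrite horner_sum [RHS]mulrCA; congr (_ * _).
rewrite mulr_sumr; apply: eq_big_nat => k /andP[_ kn].
rewrite !hornerE mulrDr mulrC; congr (_ + _).
  rewrite mulrA; congr (_ * _).
  rewrite -{2}(@subnK k n)// exprD -mulrA -(expi_natM k) expi_mulN mulr1//.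
by rewrite mulrC expi_natM exprD mulrA.
Qed.

(** The exponents [n - k] with [k <= n] are distinct and meet no [n + i] with [i > 0], so no two
    coefficients of [Q] mix. A nonzero coefficient of [Q] thus gives a nonzero polynomial. *)
Lemma coef_Qpoly Q a b k : (k <= n)%N ->
  (Qpoly Q a b)`_(n - k) = (if k == 0%N then 1 else 2^-1) * rC (Q k a b).
Proof.
move=> kn; rewrite mxE coefD !coefCM coefXn coef_sum.
case: k kn => [|k] kn.
  rewrite subn0 eqxx mulr1 /= mul1r big_nat_cond big1 ?mulr0 ?addr0// => i /andP[/andP[i0 ni] _].
  rewrite coefD !coefCM !coefXn.
  have /negPf -> : n != (n - i)%N by apply/eqP; move: i0 ni; lia.
  have /negPf -> : n != (n + i)%N by apply/eqP; move: i0 ni; lia.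
  by rewrite !mulr0 addr0.
have /negPf -> : (n - k.+1)%N != n by apply/eqP; lia.
rewrite mulr0 add0r; congr (_ * _).
rewrite (big_rem k.+1) /=; last by rewrite mem_index_iota.
rewrite coefD !coefCM !coefXn eqxx mulr1.
have /negPf -> : (n - k.+1)%N != (n + k.+1)%N by apply/eqP; lia.
rewrite mulr0 addr0 big_seq big1 ?addr0// => i.
rewrite mem_rem_uniq ?iota_uniq// !inE mem_index_iota => /andP[ik /andP[i0 ni]].
rewrite coefD !coefCM !coefXn.
have /negPf -> : (n - k.+1)%N != (n - i)%N by move: ik => /eqP ik; apply/eqP; lia.
have /negPf -> : (n - k.+1)%N != (n + i)%N by apply/eqP; lia.
by rewrite !mulr0 addr0.
Qed.

Lemma finite_Qeval_eq0 Q k a b : (k <= n)%N -> Q k a b != 0 ->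
  finite_set [set t | Tset t /\ Qeval n Q t = 0].
Proof.
move=> kn Q0.
have P0 : Qpoly Q a b != 0.
  apply: contraNneq Q0 => P0; have := coef_Qpoly Q a b kn; rewrite P0 coef0.
  move=> /esym/eqP; rewrite mulf_eq0 => /orP[|/eqP/complexI ->//].
  by case: ifP; rewrite ?oner_eq0// invr_eq0 pnatr_eq0.
apply: sub_finite_set (finite_root_expi P0) => t /= [Tt Qt]; split=> //.
by rewrite horner_Qpoly Qt mxE mulr0.
Qed.

Lemma horner_det_Qpoly Q t :
  (\det (Qpoly Q)).[expi t] = (expi t ^+ n) ^+ m * \det (Qeval n Q t).
Proof.
rewrite -[LHS]/(horner_eval (expi t) (\det (Qpoly Q))) -det_map_mx -detZ.
by congr (\det _); apply/matrixP => a b; rewrite [LHS]mxE [RHS]mxE /= /horner_eval horner_Qpoly.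
Qed.

Lemma finite_det_Qeval_eq0 Q : ~ (forall t, \det (Qeval n Q t) = 0) ->
  finite_set [set t | Tset t /\ \det (Qeval n Q t) = 0].
Proof.
move=> H.
have P0 : \det (Qpoly Q) != 0.
  apply/negP => /eqP P0; apply: H => t.
  have := horner_det_Qpoly Q t; rewrite P0 horner0 => /esym/eqP.
  by rewrite mulf_eq0 !expf_eq0 (negbTE (expi_neq0 t)) !andbF => /eqP.
apply: sub_finite_set (finite_root_expi P0) => t [Tt Qt]; split; first exact: Tt.
by rewrite horner_det_Qpoly Qt mulr0.
Qed.

Lemma Qeval_expi Q t t' : expi t = expi t' -> Qeval n Q t = Qeval n Q t'.
Proof.
pose F z := cmx (Q 0%N) + 2^-1 *:
  \sum_(1 <= k < n.+1) ((z ^+ k)^* *: cmx (Q k) + z ^+ k *: cmx (Q k)^T).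
have H x : Qeval n Q x = F (expi x).
  by congr (_ + _ *: _); apply: eq_bigr => k _; rewrite -conj_expi expi_natM.
move=> tt.
rewrite (H t).
rewrite tt.
exact/esym/H.
Qed.

Lemma peval_expi (p : nat -> R) t t' : expi t = expi t' -> peval n p t = peval n p t'.
Proof.
move=> tt; rewrite /peval; congr (_ + _); apply: eq_bigr => k _; congr (_ * _).
have h := congr1 (@complex.Re R) (expi_natM k t); rewrite /= in h.
have h' := congr1 (@complex.Re R) (expi_natM k t'); rewrite /= in h'.
by rewrite h h' tt.
Qed.
End Qpoly.

(** * Vanishing order and coefficient bounds of trigonometric polynomials *)

Section trigsum.
Variable R : realType.
Local Notation C := R[i].
Local Notation rC := (real_complex R).

Lemma normr_sin_le (x : R) : `|sin x| <= `|x|.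
Proof.
wlog x0 : x / 0 < x.
  move=> H; have [/H//|x0|<-] := ltrgtP 0 x; last by rewrite sin0 normr0.
  by rewrite -normrN -sinN -[leRHS]normrN; apply: H; rewrite oppr_gt0.
have [|c _] := @MVT R sin cos 0 x x0 (fun c _ => is_derive_sin c).
  by apply: continuous_subspaceT => ?; exact: continuous_sin.
rewrite sin0 !subr0 => ->; rewrite normrM ler_piMl//; exact: cos_max.
Qed.

Lemma one_sub_cos_le (x : R) : 1 - cos x <= x ^+ 2.
Proof.
have -> : cos x = 1 - 2 * sin (x / 2) ^+ 2.
  have {1}-> : x = (x / 2) *+ 2 by rewrite -mulr_natr mulrAC -mulrA mulfV ?mulr1.
  by rewrite cos_mulr2n cos2sin2; ring.
have : sin (x / 2) ^+ 2 <= (x / 2) ^+ 2.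
  by rewrite -[leLHS]real_normK ?num_real// -[leRHS]real_normK ?num_real// lerXn2r ?nnegrE// normr_sin_le.
have := sqr_ge0 x; rewrite expr_div_n; lra.
Qed.

(** A common form for [p], which has cosines only, and for the quadratic form of [Q] at a fixed
    complex vector, which also has sines. *)
Definition trigsum (n : nat) (a b : nat -> R) (t : R) : R :=
  a 0%N + \sum_(1 <= k < n.+1) (a k * cos (k%:R * t) + b k * sin (k%:R * t)).

(* f (t0 + u) <= f (t0 + u) + f (t0 - u), which is even in u and vanishes at 0 *)
Lemma nonneg_trigsum_zero n a b (t0 : R) :
  (forall t, 0 <= trigsum n a b t) -> trigsum n a b t0 = 0 ->
  exists2 K, 0 < K & forall u, trigsum n a b (t0 + u) <= K * u ^+ 2.
Proof.
move=> f0 ft0.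
pose c k := a k * cos (k%:R * t0) + b k * sin (k%:R * t0).
have H u : trigsum n a b (t0 + u) + trigsum n a b (t0 - u)
    = - (2 * \sum_(1 <= k < n.+1) c k * (1 - cos (k%:R * u))).
  have -> : trigsum n a b (t0 + u) + trigsum n a b (t0 - u) =
      2 * a 0%N + 2 * \sum_(1 <= k < n.+1) c k * cos (k%:R * u).
    rewrite /trigsum addrACA -big_split /= mulr_natl mulr2n; congr (_ + _).
    rewrite mulr_sumr; apply: eq_bigr => k _.
    rewrite /c !mulrDr !mulrN cosD cosB sinD sinB; ring.
  have -> : a 0%N = - \sum_(1 <= k < n.+1) c k.
    by apply/eqP; rewrite -subr_eq0 opprK; apply/eqP.
  rewrite -mulrDr -mulrN addrC -sumrB -sumrN; congr (_ * _).
  by apply: eq_bigr => k _; ring.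
(* Termwise from [1 - cos (k u) <= k^2 u^2]; the summand 1 makes the constant positive. *)
exists (1 + 2 * \sum_(1 <= k < n.+1) `|c k| * k%:R ^+ 2).
  by apply: ltr_pwDl => //; rewrite mulr_ge0// sumr_ge0.
move=> u; apply: (@le_trans _ _ (trigsum n a b (t0 + u) + trigsum n a b (t0 - u))).
  by rewrite lerDl.
rewrite H -mulrN -sumrN; apply: (@le_trans _ _ (2 * (\sum_(1 <= k < n.+1) `|c k| * k%:R ^+ 2) * u ^+ 2)).
  rewrite -mulrA ler_pM2l// mulr_suml; apply: ler_sum => k _.
  rewrite -mulNr -mulrA -exprMn; apply: (@le_trans _ _ (`|c k| * (1 - cos (k%:R * u)))).
    by rewrite ler_wpM2r ?subr_ge0 ?cos_le1// -normrN ler_norm.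
  by rewrite ler_wpM2l// one_sub_cos_le.
by rewrite [leRHS]mulrDl mul1r lerDr sqr_ge0.
Qed.

Lemma Re_qf_Qeval (m n : nat) (Q : nat -> 'M[R]_m) (x : 'cV[C]_m) :
  exists a b, forall t,
    complex.Re ((ctr x *m Qeval n Q t *m x) 0 0) = trigsum n a b t.
Proof.
pose q (A : 'M[C]_m) := (ctr x *m A *m x) 0 0.
have qD A B : q (A + B) = q A + q B by rewrite /q mulmxDr mulmxDl mxE.
have qZ s A : q (s *: A) = s * q A by rewrite /q -scalemxAr -scalemxAl mxE.
have q0 : q 0 = 0 by rewrite /q mulmx0 mul0mx mxE.
pose z k := q (cmx (Q k)); pose w k := q (cmx (Q k)^T).
exists (fun k => if k == 0%N then complex.Re (z 0%N) else
          2^-1 * (complex.Re (z k) + complex.Re (w k))),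
  (fun k => 2^-1 * (complex.Im (z k) - complex.Im (w k))).
move=> t; rewrite -/(q _) /Qeval qD qZ (big_morph q qD q0) ReD /trigsum /=; congr (_ + _).
rewrite mulr_sumr Re_sum; apply: eq_big_nat => k /andP[k0 _].
rewrite qD !qZ -/(z k) -/(w k) -conj_expi gtn_eqF//.
have -> : 2^-1 = rC 2^-1 by rewrite rmorphV ?unitfE// rmorph_nat.
by case: (z k) => p1 p2; case: (w k) => r1 r2 /=; field.
Qed.

Section grid.
Variable n : nat.
(** For frequencies [j, k <= n], the sum [j + k] stays below [2 n + 1], so it is not aliased to
    frequency zero on the grid. *)
Let M := (2 * n + 1)%N.
Let h : R := 2 * pi / M%:R.
Let t_ (l : nat) : R := l%:R * h.

Let M0 : 0 < M%:R :> R. Proof. by rewrite ltr0n /M addn1. Qed.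

(** A geometric sum over roots of unity. Its ratio is not 1, because
    [1 - cos (j h) = 2 sin^2 (j h / 2)] and [j h / 2] lies strictly between 0 and [pi]. *)
Lemma sum_cos_grid (j : nat) : (0 < j < M)%N -> \sum_(l < M) cos (j%:R * t_ l) = 0.
Proof.
move=> /andP[j0 jM].
have E : \sum_(l < M) expi (j%:R * h) ^+ l = 0.
  have /eqP := subrX1 (expi (j%:R * h)) M.
  rewrite -expi_natM (_ : M%:R * (j%:R * h) = j%:R * (2 * pi)); last first.
    by rewrite /h; field; rewrite gt_eqF.
  rewrite expi_natM {1}/expi (mulr_natl pi 2) cos2pi sin2pi.
  rewrite [X in X ^+ _](_ : _ = 1)// expr1n subrr eq_sym mulf_eq0 => /orP[|/eqP//].
  rewrite subr_eq0 => /eqP /(congr1 (@complex.Re R)) /= c1.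
  have s0 : 0 < sin (j%:R * h / 2).
    apply: sin_gt0_pi; rewrite /h; apply/andP; split.
      apply: divr_gt0 => //; apply: mulr_gt0; first by rewrite ltr0n.
      by apply: divr_gt0 => //; rewrite mulr_gt0 ?pi_gt0.
    rewrite (_ : _ / 2 = pi * (j%:R / M%:R)); last by field; rewrite gt_eqF.
    by rewrite -[ltRHS]mulr1 ltr_pM2l ?pi_gt0// ltr_pdivrMr// mul1r ltr_nat.
  have : cos (j%:R * h) = 1 - 2 * sin (j%:R * h / 2) ^+ 2.
    have {1}-> : j%:R * h = (j%:R * h / 2) *+ 2 by rewrite -mulr_natr; field.
    by rewrite cos_mulr2n cos2sin2; ring.
  rewrite c1 => /eqP; rewrite -subr_eq0 opprB addrC subrK mulf_eq0 pnatr_eq0 /=.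
  by rewrite expf_eq0 /= gt_eqF.
have := congr1 (@complex.Re R) E; rewrite Re_sum /= => {2}<-.
apply: eq_bigr => l _; rewrite -expi_natM /= /t_; congr cos.
by ring.
Qed.

Lemma sum_cos_grid0 : \sum_(l < M) cos (0%:R * t_ l) = M%:R.
Proof.
under eq_bigr => l _ do rewrite mul0r cos0.
by rewrite sumr_const card_ord.
Qed.

(* Discrete orthogonality on [2 n + 1] equispaced points replaces Fourier integrals. *)
Lemma sum_cos_cos_grid (j k : nat) : (0 < j <= n)%N -> (0 < k <= n)%N ->
  \sum_(l < M) cos (j%:R * t_ l) * cos (k%:R * t_ l)
  = if j == k then M%:R / 2 else 0.
Proof.
wlog jk : j k / (j <= k)%N.
  move=> H hj hk; have [/H|kj] := leqP j k; first exact.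
  under eq_bigr => l _ do rewrite mulrC.
  by rewrite eq_sym H// ltnW.
move=> /andP[j0 jn] /andP[k0 kn].
have -> : \sum_(l < M) cos (j%:R * t_ l) * cos (k%:R * t_ l) =
   (\sum_(l < M) cos ((k + j)%:R * t_ l) + \sum_(l < M) cos ((k - j)%:R * t_ l)) / 2.
  rewrite -big_split /= mulr_suml; apply: eq_bigr => l _.
  by rewrite natrD (natrB _ jk) (mulrDl (k%:R)) (mulrBl _ k%:R) cosD cosB; field.
rewrite sum_cos_grid; last by rewrite /M; lia.
rewrite add0r; case: eqP => [->|/eqP jk']; first by rewrite subnn sum_cos_grid0.
by rewrite sum_cos_grid ?mul0r// /M; move/eqP: jk'; lia.
Qed.

(** For [k > 0], [p_k / 2] is the grid average of [p cos (k t)]. Since [p] is nonnegative, this is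
    bounded by the average of [p], which is [p_0 = 1]. *)
Lemma nonneg_peval_coef_le (p : nat -> R) : p 0%N = 1 ->
  (forall t, 0 <= peval n p t) -> forall k, (k <= n)%N -> `|p k| <= 2.
Proof.
move=> p01 p0 [|k kn]; first by rewrite p01 normr1 ler1n.
have S0 : \sum_(l < M) peval n p (t_ l) = M%:R.
  rewrite /peval big_split /= p01 sumr_const card_ord exchange_big /=.
  rewrite big_nat_cond big1 ?addr0// => j /andP[/andP[j0 jn] _].
  by rewrite -mulr_sumr sum_cos_grid ?mulr0// /M; lia.
have Sk : \sum_(l < M) peval n p (t_ l) * cos (k.+1%:R * t_ l) = p k.+1 * (M%:R / 2).
  under eq_bigr => l _ do rewrite /peval mulrDl.
  rewrite big_split /= -mulr_sumr sum_cos_grid ?mulr0 ?add0r; last by rewrite /M; lia.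
  under eq_bigr => l _ do rewrite mulr_suml.
  rewrite exchange_big /= (big_rem k.+1) /=; last by rewrite mem_index_iota.
  under eq_bigr => l _ do rewrite -mulrA.
  rewrite -mulr_sumr sum_cos_cos_grid ?eqxx; [|lia|lia].
  rewrite big_seq big1 ?addr0// => i.
  rewrite mem_rem_uniq ?iota_uniq// !inE mem_index_iota => /andP[ik /andP[i0 ni]].
  under eq_bigr => l _ do rewrite -mulrA.
  by rewrite -mulr_sumr sum_cos_cos_grid ?(negbTE ik) ?mulr0//; lia.
have : `|p k.+1| * (M%:R / 2) <= M%:R.
  rewrite -[X in _ * X]ger0_norm; last by rewrite divr_ge0// ltW.
  rewrite -normrM -Sk -[leRHS]S0; apply: (le_trans (ler_norm_sum _ _ _)).
  apply: ler_sum => l _; rewrite normrM ger0_norm// ler_piMr//; exact: cos_max.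
by rewrite mulrA ler_pdivrMr// mulrC ler_pM2l.
Qed.

Lemma nonneg_peval_le (p : nat -> R) t : p 0%N = 1 ->
  (forall t, 0 <= peval n p t) -> peval n p t <= (1 + 2 * n)%:R.
Proof.
move=> p01 p0; rewrite /peval p01 natrD lerD2l.
apply: (@le_trans _ _ (\sum_(1 <= k < n.+1) 2)).
  rewrite big_nat_cond [leRHS]big_nat_cond; apply: ler_sum => k /andP[/andP[_ kn] _].
  apply: (le_trans (ler_norm _)); rewrite normrM -[leRHS]mulr1 ler_pM ?cos_max//.
  exact: nonneg_peval_coef_le.
by rewrite big_const_nat iter_addr_0 subSS subn0 natrM mulr_natr.
Qed.
End grid.
End trigsum.

(** * Integration over one period *)

Section integrals.
Variable R : realType.
Local Notation mu := (@lebesgue_measure R).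
Local Notation T := (@Tset R).
Implicit Types f g : R -> R.

Lemma measurable_Tset : measurable T.
Proof. exact: measurable_itv. Qed.
Local Hint Resolve measurable_Tset : core.

Lemma pi2_gt0 : 0 < 2 * pi :> R.
Proof. by rewrite mulr_gt0// pi_gt0. Qed.

Lemma Tset_measure : mu T = (2 * pi)%:E.
Proof. by rewrite /Tset lebesgue_measure_itv /= lte_fin pi2_gt0 oppr0 adde0. Qed.

Local Open Scope ereal_scope.

Lemma integral_Tset_cst (r : R) : \int[mu]_(t in T) r%:E = (r * (2 * pi))%:E.
Proof. by rewrite integral_cst//= Tset_measure. Qed.

(** The integrands of the objective are bounded below but may have integral +oo. Adding a constant
    turns them into nonnegative functions, and the identity stays valid in the infinite case. *)
Lemma ge0_integral_lower_bounded f (K : R) : (0 <= K)%R -> measurable_fun T f ->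
  (forall t, T t -> (- K <= f t)%R) ->
  \int[mu]_(t in T) (f t)%:E + (K * (2 * pi))%:E = \int[mu]_(t in T) (f t + K)%:E.
Proof.
move=> K0 mf fK.
have mF : measurable_fun T (EFin \o f) by exact/measurable_EFinP.
rewrite integralE.
set A := \int[mu]_(t in T) _^\+ t; set B := \int[mu]_(t in T) _^\- t.
have B0 : 0 <= B by apply: integral_ge0 => t _; exact: funeneg_ge0.
have Bfin : B \is a fin_num.
  rewrite ge0_fin_numE//; apply: (@le_lt_trans _ _ (K * (2 * pi))%:E); last exact: ltry.
  rewrite -integral_Tset_cst; apply: ge0_le_integral => //.
  - exact: measurable_funeneg.
  - by move=> t Tt; rewrite funenegE /= -EFin_max lee_fin ge_max lerNl fK.
(* The identity [(f + K) + f^- = f^+ + K] is integrated; only the integral of [f^-] has to be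
   finite. *)
have -> : \int[mu]_(t in T) (f t + K)%:E + B = A + (K * (2 * pi))%:E -> 
   A - B + (K * (2 * pi))%:E = \int[mu]_(t in T) (f t + K)%:E.
  move=> E; rewrite addeAC -E addeK//.
- by [].
rewrite -integral_Tset_cst -!ge0_integralD//.
- apply: eq_integral => t _.
  rewrite funeposE funenegE -EFinN -!EFin_max -!EFinD; congr (_%:E).
  by case: (leP (f t) 0%R); case: (leP (- f t)%R 0%R); lra.
- exact: measurable_funepos.
- by move=> t Tt; rewrite lee_fin -lerBlDr sub0r fK.
- by apply/measurable_EFinP; exact: measurable_funD.
- exact: measurable_funeneg.
Qed.

(** The common form of both boundary estimates: a gain [c] on an interval of length [d] is worth
    [c d]. The finite set [Z] absorbs the angles where default values spoil the pointwise
    comparison. *)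
Lemma ae_le_integral_gain f g (K c d t0 : R) (Z : set R) : (0 <= K)%R ->
  measurable_fun T f -> measurable_fun T g ->
  (forall t, T t -> (- K <= f t)%R) -> (forall t, T t -> (- K <= g t)%R) ->
  (0 <= c)%R -> (0 <= d)%R -> `[t0, (t0 + d)%R[ `<=` T -> finite_set Z ->
  (forall t, T t -> ~ Z t -> (f t + c * \1_(`[t0, (t0 + d)%R[%classic) t <= g t)%R) ->
  \int[mu]_(t in T) (f t)%:E + (c * d)%:E <= \int[mu]_(t in T) (g t)%:E.
Proof.
move=> K0 mf mg fK gK c0 d0 IT Zf fg.
rewrite -(@leeD2rE _ (K * (2 * pi))%:E)// addeAC !ge0_integral_lower_bounded//.
have mI : measurable (`[t0, (t0 + d)%R[ : set R) by exact: measurable_itv.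
have -> : (c * d)%:E = \int[mu]_(t in T) (c * \1_(`[t0, (t0 + d)%R[%classic) t)%:E.
  under eq_integral do rewrite EFinM.
  rewrite ge0_integralZl_EFin//; last first.
    by apply/measurable_EFinP/measurable_indic.
  rewrite integral_indic// setIidl// EFinM; congr (_ * _).
  have := lebesgue_measure_itv `[t0, (t0 + d)%R[%R; rewrite /= lte_fin ltrDl => ->.
  case: ltrP => [_|dl0]; first by rewrite -EFinD addrAC subrr add0r.
  by have -> : d = 0%R by apply/eqP; rewrite eq_le dl0.
have f0 t : T t -> 0 <= (f t + K)%:E by move=> Tt; rewrite lee_fin -lerBlDr sub0r fK.
have g0 t : T t -> 0 <= (g t + K)%:E by move=> Tt; rewrite lee_fin -lerBlDr sub0r gK.
have h0 t : T t -> 0 <= (c * \1_(`[t0, (t0 + d)%R[%classic) t)%:E.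
  by move=> Tt; rewrite lee_fin mulr_ge0.
have mf' : measurable_fun T (fun t => (f t + K)%:E).
  by apply/measurable_EFinP; exact: measurable_funD.
have mg' : measurable_fun T (fun t => (g t + K)%:E).
  by apply/measurable_EFinP; exact: measurable_funD.
have mh' : measurable_fun T (fun t => (c * \1_(`[t0, (t0 + d)%R[%classic) t)%:E).
  by apply/measurable_EFinP; apply: measurable_funM => //; exact: measurable_indic.
rewrite -ge0_integralD//; apply: ae_ge0_le_integral => //.
- by move=> t Tt; exact: adde_ge0 (f0 t Tt) (h0 t Tt).
- exact: emeasurable_funD.
exists Z; split.
- by apply: countable_measurable => //; exact: finite_set_countable.
- by apply: countable_lebesgue_measure0; exact: finite_set_countable.
move=> t /= H; apply: contrapT => Zt; apply: H => Tt.
by rewrite -EFinD lee_fin addrAC lerD2r fg.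
Qed.

Lemma ae_le_integral f g (K : R) (Z : set R) : (0 <= K)%R ->
  measurable_fun T f -> measurable_fun T g ->
  (forall t, T t -> (- K <= f t)%R) -> (forall t, T t -> (- K <= g t)%R) ->
  finite_set Z -> (forall t, T t -> ~ Z t -> (f t <= g t)%R) ->
  \int[mu]_(t in T) (f t)%:E <= \int[mu]_(t in T) (g t)%:E.
Proof.
move=> K0 mf mg fK gK Zf fg.
have := @ae_le_integral_gain f g K 0 0 0 Z K0 mf mg fK gK (lexx _) (lexx _).
rewrite mul0r adde0; apply => //.
  by move=> t /=; rewrite in_itv /= addr0 => /andP[a b]; have := le_lt_trans a b; rewrite ltxx.
by move=> t Tt Zt; rewrite mul0r addr0 fg.
Qed.

Lemma integral_lower_bound g (K : R) : (0 <= K)%R -> measurable_fun T g ->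
  (forall t, T t -> (- K <= g t)%R) ->
  (- K * (2 * pi))%:E <= \int[mu]_(t in T) (g t)%:E.
Proof.
move=> K0 mg gK; rewrite -integral_Tset_cst.
by apply: (@ae_le_integral (fun=> - K)%R g K set0) => // t Tt _; exact: gK.
Qed.

Lemma continuous_measurable_Tset f : continuous f -> measurable_fun T f.
Proof.
move=> cf; apply: measurable_funTS.
by apply: continuous_measurable_fun.
Qed.

Lemma continuous_integrable_Tset f : continuous f -> mu.-integrable T (EFin \o f).
Proof.
move=> cf; apply: (@integrableS _ _ _ mu `[0%R, (2 * pi)%R]) => //.
  by move=> t; rewrite /Tset /= !in_itv /= => /andP[-> /ltW].
apply: continuous_compact_integrable; first exact: segment_compact.
exact: continuous_subspaceT.
Qed.

Lemma continuous_integral_fin f : continuous f ->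
  \int[mu]_(t in T) (f t)%:E \is a fin_num.
Proof. by move=> cf; apply: integrable_fin_num => //; exact: continuous_integrable_Tset. Qed.

(** Only an eventual lower bound by [f t - e] is asked for, instead of convergence. This covers
    angles where the integrands diverge to +oo, and it allows [f] to be any finite function that
    they eventually exceed. *)
Lemma fatou_Tset (F : nat -> R -> R) f (K : R) (a : nat -> R) (l : R) : (0 <= K)%R ->
  (forall j, measurable_fun T (F j)) -> measurable_fun T f ->
  (forall j t, T t -> (- K <= F j t)%R) ->
  (forall t, T t -> (- K <= f t)%R) ->
  (forall j, \int[mu]_(t in T) (F j t)%:E = (a j)%:E) ->
  a @ \oo --> l ->
  (forall t, T t -> forall e : R, (0 < e)%R -> \forall j \near \oo, (f t - e <= F j t)%R) ->
  \int[mu]_(t in T) (f t)%:E <= l%:E.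
Proof.
move=> K0 mF mf FK fK Fa al fF.
rewrite -(@leeD2rE _ (K * (2 * pi))%:E)// ge0_integral_lower_bounded//.
have mF' j : measurable_fun T (fun t => (F j t + K)%:E).
  by apply/measurable_EFinP; exact: measurable_funD.
have mf' : measurable_fun T (fun t => (f t + K)%:E).
  by apply/measurable_EFinP; exact: measurable_funD.
have F0 j t : T t -> 0 <= (F j t + K)%:E.
  by move=> Tt; rewrite lee_fin -lerBlDr sub0r FK.
have := @fatou _ _ _ mu T measurable_Tset _ mF' F0.
have Fa' : (fun j => \int[mu]_(t in T) (F j t + K)%:E) =
    (fun j => (a j + K * (2 * pi))%:E).
  apply/funext => j; rewrite -ge0_integral_lower_bounded ?Fa//.
  by move=> t; exact: FK.
rewrite Fa'.
have cv : (fun j => (a j + K * (2 * pi))%:E) @ \oo --> (l + K * (2 * pi))%:E.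
  by apply: cvg_EFin; [exact: nearW|apply: cvgD => //; exact: cvg_cst].
rewrite (cvg_limn_einf_sup cv).1 EFinD => H.
apply: le_trans H; apply: ge0_le_integral => //.
- by move=> t Tt; rewrite lee_fin -lerBlDr sub0r fK.
- have -> : (fun t => limn_einf (fun j => (F j t + K)%:E))
      = (fun t => - limn_esup (fun j => - (F j t + K)%:E)).
    apply/funext => t; rewrite -limn_einfN; congr limn_einf.
    by apply/funext => j; exact/esym/oppeK.
  apply/measurableT_comp; first exact: oppe_measurable.
  apply: (@measurable_fun_limn_esup _ _ _ _ (fun j t => - (F j t + K)%:E)) => j.
  by apply/measurableT_comp; [exact: oppe_measurable|exact: mF'].
- move=> t Tt; rewrite limn_einf_lim; apply/lee_addgt0Pr => e e0.
  rewrite -leeBlDr//; apply: lime_ge; first exact: is_cvg_einfs.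
  have [N _ HN] := fF t Tt e e0.
  exists N => // j /= Nj; rewrite /einfs /=; apply: le_ereal_inf_tmp => _ [k /= jk <-].
  by rewrite -EFinB lee_fin addrAC lerD2r; apply: HN; exact: leq_trans jk.
Qed.

End integrals.

(* Otherwise unification unfolds determinants of [Qeval] at distinct arguments. *)
#[local] Opaque Qeval.

(** * Limits of determinants and quadratic forms *)

Lemma cvg_sum_seq (R : realType) (X : Type) (F : set_system X) (FF : Filter F)
    (I : eqType) (r : seq I) (f : I -> X -> R) (l : I -> R) :
  (forall i, i \in r -> f i @ F --> l i) ->
  (fun x => \sum_(i <- r) f i x) @ F --> \sum_(i <- r) l i.
Proof.
elim: r => [|i r ih] H.
  by rewrite big_nil; under eq_fun do rewrite big_nil; exact: cvg_cst.
rewrite big_cons; under eq_fun do rewrite big_cons.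
apply: cvgD; first by apply: H; rewrite mem_head.
by apply: ih => j jr; apply: H; rewrite in_cons jr orbT.
Qed.

Lemma cvg_ge0 (R : realType) (u : nat -> R) (l : R) :
  u @ \oo --> l -> (forall j, 0 <= u j) -> 0 <= l.
Proof.
move=> ul u0; rewrite -(cvg_lim (@Rhausdorff R) ul).
by apply: limr_ge; [apply/cvg_ex; exists l|exact: nearW].
Qed.

Section complex_limits.
Variable R : realType.
Local Notation C := R[i].
Local Notation rC := (real_complex R).

(** Complex limits are taken componentwise, so that every limit is one of real functions. *)
Definition ccvg (X : Type) (F : set_system X) (f : X -> C) (l : C) :=
  ((fun x => complex.Re (f x)) @ F --> complex.Re l) /\
  ((fun x => complex.Im (f x)) @ F --> complex.Im l).

Lemma eq_ccvg (X : Type) (F : set_system X) (f g : X -> C) (l k : C) :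
  (forall x, f x = g x) -> l = k -> ccvg F f l -> ccvg F g k.
Proof. by move=> /funext -> ->. Qed.

Section filter.
Context (X : Type) (F : set_system X) {FF : Filter F}.

Lemma ccvg_cst (l : C) : ccvg F (fun=> l) l.
Proof. by split; exact: cvg_cst. Qed.

Lemma ccvg_real (r : X -> R) (l : R) : r @ F --> l -> ccvg F (fun x => rC (r x)) (rC l).
Proof. by move=> rl; split => //=; exact: cvg_cst. Qed.

Lemma ccvgD (f g : X -> C) (l k : C) : ccvg F f l -> ccvg F g k -> ccvg F (fun x => f x + g x) (l + k).
Proof.
move=> [f1 f2] [g1 g2]; split.
  rewrite ReD; under eq_fun do rewrite ReD; exact: cvgD.
have ImD (y z : C) : complex.Im (y + z) = complex.Im y + complex.Im z by case: y; case: z.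
by rewrite ImD; under eq_fun do rewrite ImD; exact: cvgD.
Qed.

Lemma ccvgM (f g : X -> C) (l k : C) : ccvg F f l -> ccvg F g k -> ccvg F (fun x => f x * g x) (l * k).
Proof.
move=> [f1 f2] [g1 g2].
have ReM (y z : C) : complex.Re (y * z) =
  complex.Re y * complex.Re z - complex.Im y * complex.Im z by case: y; case: z.
have ImM (y z : C) : complex.Im (y * z) =
  complex.Re y * complex.Im z + complex.Im y * complex.Re z by case: y; case: z.
split.
  by rewrite ReM; under eq_fun do rewrite ReM; apply: cvgB; exact: cvgM.
by rewrite ImM; under eq_fun do rewrite ImM; apply: cvgD; exact: cvgM.
Qed.

Lemma ccvg_sum (I : eqType) (r : seq I) (f : I -> X -> C) (l : I -> C) :
  (forall i, i \in r -> ccvg F (f i) (l i)) ->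
  ccvg F (fun x => \sum_(i <- r) f i x) (\sum_(i <- r) l i).
Proof.
elim: r => [|i r ih] H.
  by rewrite big_nil; under eq_fun do rewrite big_nil; exact: ccvg_cst.
rewrite big_cons; under eq_fun do rewrite big_cons.
apply: ccvgD; first by apply: H; rewrite mem_head.
by apply: ih => j jr; apply: H; rewrite in_cons jr orbT.
Qed.

Lemma ccvg_prod (I : eqType) (r : seq I) (f : I -> X -> C) (l : I -> C) :
  (forall i, i \in r -> ccvg F (f i) (l i)) ->
  ccvg F (fun x => \prod_(i <- r) f i x) (\prod_(i <- r) l i).
Proof.
elim: r => [|i r ih] H.
  by rewrite big_nil; under eq_fun do rewrite big_nil; exact: ccvg_cst.
rewrite big_cons; under eq_fun do rewrite big_cons.
apply: ccvgM; first by apply: H; rewrite mem_head.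
by apply: ih => j jr; apply: H; rewrite in_cons jr orbT.
Qed.

Lemma ccvg_det (m : nat) (A : X -> 'M[C]_m) (L : 'M[C]_m) :
  (forall a b, ccvg F (fun x => A x a b) (L a b)) ->
  ccvg F (fun x => \det (A x)) (\det L).
Proof.
move=> H; rewrite /determinant; apply: ccvg_sum => s _.
by apply: ccvgM; [exact: ccvg_cst|apply: ccvg_prod].
Qed.

Lemma ccvg_qf (m : nat) (A : X -> 'M[C]_m) (L : 'M[C]_m) (x : 'cV[C]_m) :
  (forall a b, ccvg F (fun y => A y a b) (L a b)) ->
  ccvg F (fun y => (ctr x *m A y *m x) 0 0) ((ctr x *m L *m x) 0 0).
Proof.
move=> H; rewrite qfE; under eq_fun do rewrite qfE.
apply: ccvg_sum => a _; apply: ccvg_sum => b _.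
apply: ccvgM; last exact: ccvg_cst.
by apply: ccvgM; [exact: ccvg_cst|exact: H].
Qed.

Lemma ccvg_Qeval (m n : nat) (Q : X -> nat -> 'M[R]_m) (L : nat -> 'M[R]_m) (t : R) :
  (forall k a b, (k <= n)%N -> (fun x => Q x k a b) @ F --> L k a b) ->
  forall a b, ccvg F (fun x => Qeval n (Q x) t a b) (Qeval n L t a b).
Proof.
move=> H a b.
apply: (eq_ccvg (fun x => esym (QevalE n (Q x) t a b)) (esym (QevalE n L t a b))).
apply: ccvgD; first by apply: ccvg_real; exact: H.
apply: ccvgM; first exact: ccvg_cst.
apply: ccvg_sum => k; rewrite mem_index_iota => /andP[_ kn].
by apply: ccvgD; apply: ccvgM; try exact: ccvg_cst; apply: ccvg_real; exact: H.
Qed.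

Lemma cvg_peval (n : nat) (p : X -> nat -> R) (l : nat -> R) (t : R) :
  (forall k, (k <= n)%N -> (fun x => p x k) @ F --> l k) ->
  (fun x => peval n (p x) t) @ F --> peval n l t.
Proof.
move=> H; rewrite /peval; apply: cvgD; first exact: H.
apply: cvg_sum_seq => k; rewrite mem_index_iota => /andP[_ kn].
by apply: cvgM; [exact: H|exact: cvg_cst].
Qed.
End filter.

Lemma ccvg_Qeval_continuous (m n : nat) (Q : nat -> 'M[R]_m) (t : R) a b :
  ccvg (nbhs t) (fun x => Qeval n Q x a b) (Qeval n Q t a b).
Proof.
apply: (eq_ccvg (fun x => esym (QevalE n Q x a b)) (esym (QevalE n Q t a b))).
have cM (k : nat) : (fun x : R => k%:R * x) @ t --> k%:R * t by apply: cvgM; [exact: cvg_cst|exact: cvg_id].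
have ce (s : R -> R) : s @ t --> s t -> ccvg (nbhs t) (fun x => expi (s x)) (expi (s t)).
  by move=> st; split; apply: continuous_cvg => //; [exact: continuous_cos|exact: continuous_sin].
apply: ccvgD; first exact: ccvg_cst.
apply: ccvgM; first exact: ccvg_cst.
apply: ccvg_sum => k _.
apply: ccvgD; apply: ccvgM; try exact: ccvg_cst.
  by apply: (ce (fun x => - (k%:R * x))); exact: cvgN.
by apply: (ce (fun x => k%:R * x)).
Qed.

Lemma continuous_peval (n : nat) (p : nat -> R) : continuous (peval n p).
Proof.
move=> t; rewrite /peval; apply: cvgD; first exact: cvg_cst.
apply: cvg_sum_seq => k _; apply: cvgM; first exact: cvg_cst.
apply: continuous_cvg; first exact: continuous_cos.
by apply: cvgM; [exact: cvg_cst|exact: cvg_id].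
Qed.

Lemma continuous_Re_det (m n : nat) (Q : nat -> 'M[R]_m) :
  continuous (fun t => complex.Re (\det (Qeval n Q t))).
Proof. by move=> t; have [] := ccvg_det (@ccvg_Qeval_continuous m n Q t). Qed.

End complex_limits.

(** * Nonnegative polynomials and their limits *)

Section closures.
Variable R : realType.
Local Notation C := R[i].
Variables m n : nat.

(* Nonnegative counterparts of [Bo] and [Bm]; they contain the closures. *)
Definition Po (p : nat -> R) := p 0%N = 1 /\ forall t, 0 <= peval n p t.
Definition Pm (Q : nat -> 'M[R]_m) :=
  (Q 0%N)^T = Q 0%N /\ forall t, psd (Qeval n Q t).

Lemma Bo_Po p : Bo n p -> Po p.
Proof. by move=> [p0 pp]; split => // t; exact: ltW. Qed.

Lemma Bm_Pm Q : Bm n Q -> Pm Q.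
Proof. by move=> [Q0 QQ]; split => // t; exact: posdef_psd. Qed.

Lemma Qeval_hermitian (Q : nat -> 'M[R]_m) t : (Q 0%N)^T = Q 0%N ->
  Defs.hermitian (Qeval n Q t).
Proof.
move=> Q0 a b; rewrite QevalE (QevalE _ Q t b a) rmorphD rmorphM rmorph_sum /=.
have conjR (r : R) : (real_complex R r)^* = real_complex R r by exact: conjc_real.
have -> : Q 0%N b a = Q 0%N a b by rewrite -[in LHS]Q0 mxE.
congr (_ + _ * _); first by rewrite conjR.
  by rewrite fmorphV rmorph_nat.
apply: eq_bigr => k _; rewrite rmorphD !rmorphM /= !conjR !conj_expi opprK addrC //.
Qed.

Lemma cvg_Po (s : nat -> nat -> R) (p : nat -> R) : (forall j, Po (s j)) ->
  (forall k, (k <= n)%N -> (fun j => s j k) @ \oo --> p k) -> Po p.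
Proof.
move=> sP sp; split.
  apply: (cvg_unique (@Rhausdorff R) (sp 0%N isT)).
  rewrite [X in X @ _](_ : _ = fun=> 1); first exact: cvg_cst.
  by apply/funext => j; exact: (sP j).1.
move=> t; have cv := cvg_peval (t := t) sp.
exact: cvg_ge0 (cv _) (fun j => (sP j).2 t).
Qed.

Lemma cvg_Pm (s : nat -> nat -> 'M[R]_m) (Q : nat -> 'M[R]_m) : (forall j, Pm (s j)) ->
  (forall k a b, (k <= n)%N -> (fun j => s j k a b) @ \oo --> Q k a b) -> Pm Q.
Proof.
move=> sP sp.
have Q0 : (Q 0%N)^T = Q 0%N.
  apply/matrixP => a b; rewrite mxE.
  apply: (cvg_unique (@Rhausdorff R) (sp 0%N b a isT)).
  rewrite [X in X @ _](_ : _ = (fun j => s j 0%N a b)); first exact: sp.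
  by apply/funext => j; have := congr1 (fun A : 'M[R]_m => A a b) (sP j).1; rewrite mxE.
split => // t; split.
  exact: Qeval_hermitian.
move=> x; have [c1 c2] := ccvg_qf x (@ccvg_Qeval _ _ _ _ _ n s Q t sp).
have qP j := (sP j).2 t.
rewrite lecE /=; apply/andP; split.
  apply/eqP; apply: (cvg_unique (@Rhausdorff R) c2).
  rewrite [X in X @ _](_ : _ = fun=> 0); first exact: cvg_cst.
  by apply/funext => j; apply: ger0_Im; exact: (qP j).2.
apply: cvg_ge0 c1 _ => j.
by have := (qP j).2 x; rewrite lecE => /andP[].
Qed.

End closures.

(** * The logarithmic integrand *)

Section integrand.
Variable R : realType.
Local Notation C := R[i].
Local Notation rC := (real_complex R).
Local Notation mu := (@lebesgue_measure R).
Local Notation T := (@Tset R).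
Variables m n : nat.
Implicit Types (p : nat -> R) (Q : nat -> 'M[R]_m).

Definition integrand p Q (t : R) : R :=
  peval n p t * ln (complex.Re (\det ((peval n p t +i* 0)%C *: invmx (Qeval n Q t))))
  - m%:R * peval n p t.

Local Notation detQ Q t := (complex.Re (\det (Qeval n Q t))).

Lemma psd_det_real (M : 'M[C]_m) : psd M -> \det M = rC (complex.Re (\det M)).
Proof.
move=> /psd_det; case: (\det M) => a b /ger0_Im /= ->.
by [].
Qed.

Lemma detQ_ge0 Q t : psd (Qeval n Q t) -> 0 <= detQ Q t.
Proof. by move=> /psd_det; rewrite lecE => /andP[]. Qed.

Lemma integrandE p Q t : psd (Qeval n Q t) ->
  integrand p Q t =
  peval n p t * ln (peval n p t ^+ m * (detQ Q t)^-1) - m%:R * peval n p t.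
Proof.
move=> pQ; rewrite /integrand; congr (_ * ln _ - _).
rewrite detZ det_inv (psd_det_real pQ) -[(_ +i* 0)%C]/(rC (peval n p t)).
by rewrite -rmorphXn -fmorphV -rmorphM.
Qed.

Lemma integrand_regular p Q t : psd (Qeval n Q t) -> 0 <= peval n p t ->
  0 < detQ Q t ->
  integrand p Q t =
  m%:R * (peval n p t * ln (peval n p t) - peval n p t) - peval n p t * ln (detQ Q t).
Proof.
move=> pQ + D0; rewrite integrandE// le_eqVlt => /orP[/eqP <-|p0].
  by rewrite !mul0r mulr0 !subr0 mulr0.
by rewrite ln_div ?posrE ?exprn_gt0// lnXn// -mulr_natl; ring.
Qed.

(* Junk value: [invmx] is the identity on singular matrices and [ln 0 = 0]. *)
Lemma integrand_singular p Q t : psd (Qeval n Q t) -> detQ Q t = 0 ->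
  integrand p Q t = - (m%:R * peval n p t).
Proof. by move=> pQ D0; rewrite integrandE// D0 invr0 mulr0 ln0// mulr0 sub0r. Qed.

Definition coef_norm Q : R := \sum_(k < n.+1) \sum_a \sum_b `|Q k a b|.

Lemma coef_norm_ge0 Q : 0 <= coef_norm Q.
Proof. by rewrite !sumr_ge0// => k _; rewrite sumr_ge0// => a _; rewrite sumr_ge0. Qed.

Lemma trace_Qeval_le Q t : `|\sum_i complex.Re (Qeval n Q t i i)| <= coef_norm Q.
Proof.
have E i : complex.Re (Qeval n Q t i i) = \sum_(k < n.+1) Q k i i * cos (k%:R * t).
  rewrite QevalE ReD big_ord_recl /= mul0r cos0 mulr1; congr (_ + _).
  rewrite -[in RHS](big_mkord predT (fun k => Q k.+1 i i * cos (k.+1%:R * t))).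
  rewrite big_add1 /=; have -> : 2^-1 = rC 2^-1 by rewrite rmorphV ?unitfE// rmorph_nat.
  rewrite mulr_sumr Re_sum; apply: eq_bigr => k _ /=.
  by rewrite cosN sinN; field.
under eq_bigr => i _ do rewrite E.
rewrite exchange_big /=; apply: (le_trans (ler_norm_sum _ _ _)).
apply: ler_sum => k _; apply: (le_trans (ler_norm_sum _ _ _)).
apply: ler_sum => i _; rewrite normrM.
apply: (@le_trans _ _ `|Q k i i|); first by rewrite ler_piMr// cos_max.
by rewrite (bigD1 i)//= lerDl sumr_ge0.
Qed.

Lemma ln_detQ_le Q t : psd (Qeval n Q t) -> 0 < detQ Q t ->
  ln (detQ Q t) <= m%:R * ln (1 + coef_norm Q).
Proof.
move=> pQ D0; have N0 := coef_norm_ge0 Q.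
have N1 : 0 < 1 + coef_norm Q by rewrite ltr_pwDl.
rewrite mulr_natl -lnXn// ler_ln ?posrE ?exprn_gt0//.
apply: (le_trans (psd_det_le pQ)); apply: (le_trans (ler_norm _)).
rewrite normrX lerXn2r ?nnegrE ?(ltW N1)//.
by apply: (le_trans (trace_Qeval_le Q t)); rewrite lerDr.
Qed.

Lemma ln_le_sub1 (x : R) : 0 < x -> ln x <= x - 1.
Proof. by move=> x0; rewrite -{1}(subrK 1 x) addrC; apply: le_ln1Dx; rewrite ltrDr. Qed.

(** Apply [ln y <= y - 1] at [y = x^-1]; at [x = 0] the value of the logarithm is multiplied by
    zero. *)
Lemma xlnx_lower (x : R) : 0 <= x -> -1 <= x * ln x - x.
Proof.
rewrite le_eqVlt => /orP[/eqP <-|x0]; first by rewrite mul0r subr0 lerN10.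
have := ln_le_sub1 (etrans (invr_gt0 x) x0).
rewrite lnV ?posrE// -(ler_pM2l x0) mulrBr mulfV ?gt_eqF// mulr1 mulrN.
lra.
Qed.

(** The bound depends on [Q] only through its coefficient norm, and only logarithmically; it is thus
    uniform along bounded sequences. [B] bounds [p], the term [m] comes from [x ln x - x >= -1], and
    [m B] covers the default value [- m p] at singular angles. *)
Definition integrand_lower Q : R :=
  let B := (1 + 2 * n)%:R in m%:R * (1 + B) + B * (m%:R * ln (1 + coef_norm Q)).

Lemma integrand_lower_ge0 Q : 0 <= integrand_lower Q.
Proof.
rewrite /integrand_lower addr_ge0// mulr_ge0// ?addr_ge0// mulr_ge0//.
by rewrite ln_ge0// lerDl coef_norm_ge0.
Qed.

Lemma integrand_ge p Q t : Po n p -> psd (Qeval n Q t) ->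
  - integrand_lower Q <= integrand p Q t.
Proof.
move=> [p1 p0] pQ; rewrite /integrand_lower.
set B := (1 + 2 * n)%:R; set L := m%:R * ln (1 + coef_norm Q).
have L0 : 0 <= L by rewrite mulr_ge0// ln_ge0// lerDl coef_norm_ge0.
have pB : peval n p t <= B by exact: nonneg_peval_le.
have B0 : 0 <= B by [].
have m0 : 0 <= m%:R :> R by [].
have BL : 0 <= B * L by exact: mulr_ge0.
have := detQ_ge0 pQ; rewrite le_eqVlt => /orP[/eqP/esym D0|D0].
  rewrite integrand_singular//.
  have : m%:R * peval n p t <= m%:R * B by rewrite ler_wpM2l.
  rewrite (mulrDr m%:R 1 B) mulr1; lra.
rewrite integrand_regular//.
have h1 : m%:R * -1 <= m%:R * (peval n p t * ln (peval n p t) - peval n p t).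
  by rewrite ler_wpM2l// xlnx_lower.
have h2 : peval n p t * ln (detQ Q t) <= B * L.
  apply: (@le_trans _ _ (peval n p t * L)).
    by rewrite ler_wpM2l// ln_detQ_le.
  by rewrite ler_wpM2r.
have h3 : 0 <= m%:R * B by rewrite mulr_ge0.
rewrite (mulrDr m%:R 1 B) mulr1; lra.
Qed.

Lemma measurable_integrand p Q : Po n p -> Pm n Q -> measurable_fun T (integrand p Q).
Proof.
move=> [_ p0] [_ pQ].
(* The inverse is written as a power of exponent -1, which is measurable on the whole line and
   agrees with the inverse at 0 as well. *)
have -> : integrand p Q = (fun t =>
  peval n p t * ln (peval n p t ^+ m * (detQ Q t) `^ (-1)) - m%:R * peval n p t).
  by apply/funext => t; rewrite integrandE// powR_inv1// detQ_ge0.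
have mp : measurable_fun T (peval n p).
  exact: continuous_measurable_Tset (@continuous_peval _ n p).
have mD : measurable_fun T (fun t => detQ Q t).
  exact: continuous_measurable_Tset (@continuous_Re_det _ m n Q).
apply: measurable_funB; last by apply: measurable_funM.
apply: measurable_funM => //.
apply: measurableT_comp; first exact: measurable_ln.
apply: measurable_funM; first exact: measurable_funX.
by apply: (measurableT_comp (measurable_powR (-1))).
Qed.

Lemma continuous_integrand p Q : Bo n p -> Bm n Q -> continuous (integrand p Q).
Proof.
move=> [_ p0] [_ pQ] t.
have D0 s : 0 < detQ Q s by have := posdef_det (pQ s); rewrite ltcE => /andP[].
have -> : integrand p Q = (fun t =>
  m%:R * (peval n p t * ln (peval n p t) - peval n p t) - peval n p t * ln (detQ Q t)).
  by apply/funext => s; rewrite integrand_regular// ?ltW//; exact: posdef_psd.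
have cp := @continuous_peval _ n p t.
have cD := @continuous_Re_det _ m n Q t.
have clp : ln (peval n p x) @[x --> t] --> ln (peval n p t).
  by apply: continuous_cvg => //; exact: continuous_ln.
have clD : ln (detQ Q x) @[x --> t] --> ln (detQ Q t).
  by apply: continuous_cvg => //; exact: continuous_ln.
apply: cvgB; last exact: cvgM.
by apply: cvgM; [exact: cvg_cst|apply: cvgB => //; exact: cvgM].
Qed.

Definition shift Q (s : R) (k : nat) : 'M[R]_m := if k == 0%N then Q 0%N + s%:M else Q k.

Lemma Qeval_shift Q s t : Qeval n (shift Q s) t = Qeval n Q t + (rC s)%:M.
Proof.
apply/matrixP => a b; apply: etrans (QevalE _ _ _ _ _) _.
rewrite [RHS]mxE (QevalE n Q t a b) addrAC; congr (_ + _ * _).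
  by rewrite !mxE rmorphD rmorphMn.
by apply: eq_big_nat => -[].
Qed.

Lemma shift_Bm Q s : Pm n Q -> 0 < s -> Bm n (shift Q s).
Proof.
move=> [Q0 pQ] s0; split; first by rewrite /shift /= linearD /= Q0 tr_scalar_mx.
by move=> t; rewrite Qeval_shift; exact: psd_shift.
Qed.

Lemma ln_mul_le (x y z : R) : 0 < x -> 0 < y -> x * y <= z -> ln x + ln y <= ln z.
Proof.
move=> x0 y0 xyz; have xy0 := mulr_gt0 x0 y0.
by rewrite -lnM// ler_ln// posrE (lt_le_trans xy0).
Qed.

Lemma le_sub_mul (X P x y z : R) : 0 < P -> x + y <= z ->
  X - P * z + P * y <= X - P * x.
Proof. by move=> P0; rewrite -(ler_pM2l P0) mulrDr; lra. Qed.

(** The logarithm of [det_shift_ge]. The vector is free: it will be a null vector of [Q] at another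
    angle, nearby. *)
Lemma integrand_shift p Q s t (x : 'cV[C]_m) : 0 < peval n p t ->
  psd (Qeval n Q t) -> detQ Q t != 0 -> 0 < s -> x != 0 ->
  0 < complex.Re ((ctr x *m Qeval n Q t *m x) 0 0) /\
  integrand p (shift Q s) t + peval n p t *
     ln (1 + s * sqn x / complex.Re ((ctr x *m Qeval n Q t *m x) 0 0))
  <= integrand p Q t.
Proof.
move=> p0 pQ D0 s0 x0.
have D1 : 0 < detQ Q t by rewrite lt_neqAle eq_sym D0 detQ_ge0.
have Dc : 0 < \det (Qeval n Q t) by rewrite (psd_det_real pQ) ltcR.
have [q0 H] := det_shift_ge pQ Dc s0 x0; split => //.
rewrite -Qeval_shift in H.
have pQs : psd (Qeval n (shift Q s) t) by rewrite Qeval_shift; exact/posdef_psd/psd_shift.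
have Ds : 0 < detQ (shift Q s) t.
  by have := posdef_det (psd_shift pQ s0); rewrite -Qeval_shift ltcE => /andP[].
rewrite !integrand_regular ?(ltW p0)//.
have X0 : 0 < 1 + s * sqn x / complex.Re ((ctr x *m Qeval n Q t *m x) 0 0).
  by rewrite ltr_pwDl// divr_ge0 ?(ltW q0)// mulr_ge0 ?sqn_ge0 ?ltW.
exact (le_sub_mul _ p0 (ln_mul_le D1 X0 H)).
Qed.

Lemma Bo_lower p : Bo n p -> exists2 r, 0 < r & forall t, T t -> r <= peval n p t.
Proof.
move=> [_ p0].
have [|c _ cP] := @EVT_min R (peval n p) 0 (2 * pi) (ltW (pi2_gt0 R)).
  by apply: continuous_subspaceT => ?; exact: continuous_peval.
exists (peval n p c) => // t; rewrite /Tset /= in_itv /= => /andP[t0 t1].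
by apply: cP; rewrite in_itv /= t0 ltW.
Qed.

Lemma integral_shift_gain p Q : Bo n p -> Pm n Q ->
  ~ (forall t, \det (Qeval n Q t) = 0) -> ~ Bm n Q ->
  exists c s0 : R, [/\ 0 < c, 0 < s0 & forall s, 0 < s < s0 ->
   (\int[mu]_(t in T) (integrand p (shift Q s) t)%:E + (c * Num.sqrt s)%:E
    <= \int[mu]_(t in T) (integrand p Q t)%:E)%E].
Proof.
move=> pB QP Q0 nB; have pP := Bo_Po pB; have [Qs pQ] := QP.
have [t1 [x [x0 qx]]] : exists t (x : 'cV[C]_m),
    x != 0 /\ complex.Re ((ctr x *m Qeval n Q t *m x) 0 0) = 0.
  apply: contrapT => H; apply: nB; split=> // t; split; first exact: (pQ t).1.
  move=> x x0; have := (pQ t).2 x; rewrite le_eqVlt => /orP[/eqP q0|//].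
  by exfalso; apply: H; exists t, x; rewrite -q0.
have [t0 Tt0 et0] := expi_representative t1.
rewrite -(Qeval_expi n Q et0) in qx.
have [a [b qE]] := Re_qf_Qeval n Q x.
have [||K K0 qK] := @nonneg_trigsum_zero _ n a b t0.
- by move=> t; rewrite -qE; have := (pQ t).2 x; rewrite lecE => /andP[].
- by rewrite -qE.
have [r r0 rp] := Bo_lower pB.
have sx := sqn_gt0 x0.
have c0 : 0 < r * ln (1 + sqn x / K) by rewrite mulr_gt0// ln_gt0// ltrDl divr_gt0.
have h0 : 0 < 2 * pi - t0 by move: Tt0; rewrite /Tset /= in_itv /= subr_gt0 => /andP[].
have t00 : 0 <= t0 by move: Tt0; rewrite /Tset /= in_itv /= => /andP[].
(* The height of the gain uses the lower bound [r] of [p]; the threshold for [s] keeps the interval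
   from [t0] to [t0 + sqrt s] inside the period. *)
exists (r * ln (1 + sqn x / K)), ((2 * pi - t0) ^+ 2); split => //.
  by rewrite exprn_gt0.
move=> s /andP[s0 s1].
have ss : Num.sqrt s < 2 * pi - t0.
  by rewrite -(ger0_norm (ltW h0)) -sqrtr_sqr ltr_sqrt// exprn_gt0.
pose KK := integrand_lower Q + integrand_lower (shift Q s).
have sP : Pm n (shift Q s) by apply: Bm_Pm; exact: shift_Bm.
(* The exceptional set consists of the singular angles, where the default value of the logarithm may
   break the comparison. [KK] bounds both integrands from below. *)
apply: (@ae_le_integral_gain _ _ _ KK _ _ t0 [set t | Tset t /\ \det (Qeval n Q t) = 0]).
- by rewrite addr_ge0// integrand_lower_ge0.
- exact: measurable_integrand.
- exact: measurable_integrand.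
- move=> t _; apply: le_trans (integrand_ge pP (sP.2 t)).
  by rewrite lerN2 lerDr integrand_lower_ge0.
- move=> t _; apply: le_trans (integrand_ge pP (pQ t)).
  by rewrite lerN2 lerDl integrand_lower_ge0.
- exact: ltW.
- exact: sqrtr_ge0.
- move=> t; rewrite /Tset /= !in_itv /= => /andP[h1 h2]; apply/andP; split.
    exact: le_trans h1.
  by apply: lt_trans h2 _; rewrite addrC -ltrBrDr.
- exact: finite_det_Qeval_eq0.
move=> t Tt nt.
have dQ : detQ Q t != 0.
  by apply/negP => /eqP d0; apply: nt; split => //; rewrite (psd_det_real (pQ t)) d0.
have [q0 gain] := integrand_shift (pB.2 t) (pQ t) dQ s0 x0.
apply: le_trans gain; rewrite lerD2l indicE.
have l0 : 0 <= ln (1 + s * sqn x / complex.Re ((ctr x *m Qeval n Q t *m x) 0 0)).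
  by rewrite ln_ge0// lerDl divr_ge0 ?(ltW q0)// mulr_ge0 ?sqn_ge0 ?ltW.
have [/set_mem|_] := boolP (t \in _); last first.
  by rewrite mulr0 mulr_ge0// ltW// pB.2.
rewrite /= in_itv /= mulr1 => /andP[h1 h2].
apply: ler_pM; [exact: ltW|by rewrite ln_ge0// lerDl divr_ge0 ?ltW|exact: rp|].
have X1 : 0 < 1 + sqn x / K by rewrite ltr_pwDl// divr_ge0 ?ltW.
have X2 : 0 < 1 + s * sqn x / complex.Re ((ctr x *m Qeval n Q t *m x) 0 0).
  by rewrite ltr_pwDl// divr_ge0 ?(ltW q0)// mulr_ge0 ?sqn_ge0 ?ltW.
rewrite ler_ln ?posrE// lerD2l ler_pdivrMr// mulrAC ler_pdivlMr//.
rewrite [leRHS]mulrAC [leRHS]mulrC ler_pM2l//.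
rewrite qE; have -> : t = t0 + (t - t0) by rewrite addrC subrK.
apply: (le_trans (qK _)); rewrite mulrC ler_pM2r//.
have u0 : 0 <= t - t0 by rewrite subr_ge0.
rewrite -[leRHS]sqr_sqrtr ?(ltW s0)// lerXn2r ?nnegrE// ?sqrtr_ge0//.
by rewrite lerBlDl ltW.
Qed.
End integrand.

(** * Boundary points and compactness *)

Section boundary_p.
Variable R : realType.
Local Notation mu := (@lebesgue_measure R).
Local Notation T := (@Tset R).
Variable n : nat.

(** [p] is read as a 1 x 1 matrix polynomial, nonzero because its constant coefficient is 1. *)
Lemma finite_peval_eq0 (p : nat -> R) : p 0%N = 1 ->
  finite_set [set t | T t /\ peval n p t = 0].
Proof.
move=> p1; pose Q (k : nat) : 'M[R]_1 := const_mx (p k).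
have Q0 : Q 0%N 0 0 != 0 by rewrite mxE p1 oner_neq0.
apply: sub_finite_set (@finite_Qeval_eq0 R 1 n Q 0%N 0 0 isT Q0) => t [Tt pt].
split; first exact: Tt.
apply/matrixP => a b; rewrite !ord1; apply: etrans (QevalE n Q t 0 0) _.
have -> : 2^-1 = real_complex R 2^-1 by rewrite rmorphV ?unitfE// rmorph_nat.
rewrite mulr_sumr [RHS]mxE; move: pt; rewrite /peval => pt.
rewrite -[RHS]/(real_complex R 0) -pt rmorphD rmorph_sum /=; congr (_ + _); first by rewrite mxE.
apply: eq_bigr => k _; rewrite !mxE /expi cosN sinN.
by apply/eqP; rewrite eq_complex /=; apply/andP; split; apply/eqP; field.
Qed.

Lemma measurable_inv_peval (p : nat -> R) : Po n p -> measurable_fun T (fun t => (peval n p t)^-1).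
Proof.
move=> [_ p0].
have -> : (fun t => (peval n p t)^-1) = (fun t => peval n p t `^ (-1)).
  by apply/funext => t; rewrite powR_inv1.
apply: (measurableT_comp (measurable_powR (-1))).
exact: continuous_measurable_Tset (@continuous_peval _ n p).
Qed.

Lemma integral_inv_boundary (p : nat -> R) : Po n p -> ~ Bo n p ->
  (\int[mu]_(t in T) ((peval n p t)^-1)%:E = +oo)%E.
Proof.
move=> pP nB; have [p1 p0] := pP.
have [t1 pt1] : exists t, peval n p t = 0.
  apply: contrapT => H; apply: nB; split=> // t; rewrite lt_neqAle p0 andbT eq_sym.
  by apply/negP => /eqP pt; apply: H; exists t.
have [t0 Tt0 et0] := expi_representative t1.
rewrite -(peval_expi n p et0) in pt1.
have pE t : peval n p t = trigsum n p (fun=> 0) t.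
  by rewrite /peval /trigsum; congr (_ + _); apply: eq_bigr => k _; rewrite mul0r addr0.
have [||K K0 pK] := @nonneg_trigsum_zero _ n p (fun=> 0) t0.
- by move=> t; rewrite -pE.
- by rewrite -pE.
have h0 : 0 < 2 * pi - t0 by move: Tt0; rewrite /Tset /= in_itv /= subr_gt0 => /andP[].
have t00 : 0 <= t0 by move: Tt0; rewrite /Tset /= in_itv /= => /andP[].
apply/eqyP => A A0.
(* Near [t0] one has [p <= K d^2], so an interval of length [d] contributes at least [1 / (K d)].
   The second bound on [d] makes this at least [A]; the first keeps the interval in the period. *)
pose d := Num.min ((2 * pi - t0) / 2) (K * A)^-1.
have d0 : 0 < d by rewrite lt_min divr_gt0//= invr_gt0 mulr_gt0.
have d1 : d < 2 * pi - t0.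
  by apply: (@le_lt_trans _ _ ((2 * pi - t0) / 2)); [rewrite ge_min lexx|lra].
have dA : A <= (K * d ^+ 2)^-1 * d.
  have -> : (K * d ^+ 2)^-1 * d = (K * d)^-1 by field; rewrite !gt_eqF.
  rewrite -[leLHS]invrK lef_pV2 ?posrE ?invr_gt0 ?mulr_gt0//.
  have : d <= (K * A)^-1 by rewrite ge_min lexx orbT.
  by rewrite invfM mulrC ler_pdivlMr// mulrC.
apply: (@le_trans _ _ ((K * d ^+ 2)^-1 * d)%:E); first by rewrite lee_fin.
(* The zeros of [p] are excepted because the inverse has the default value 0 there. *)
have := @ae_le_integral_gain R (fun=> 0) (fun t => (peval n p t)^-1) 0
  (K * d ^+ 2)^-1 d t0 [set t | T t /\ peval n p t = 0].
rewrite integral0 add0e; apply => //.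
- exact: measurable_inv_peval.
- by move=> t _; rewrite oppr0 invr_ge0.
- by rewrite invr_ge0 mulr_ge0 ?sqr_ge0// ltW.
- exact: ltW.
- move=> t; rewrite /Tset /= !in_itv /= => /andP[g1 g2]; apply/andP; split.
    exact: le_trans g1.
  by apply: lt_trans g2 _; rewrite addrC -ltrBrDr.
- exact: finite_peval_eq0.
move=> t Tt nt; rewrite add0r indicE.
have pt : 0 < peval n p t.
  by rewrite lt_neqAle p0 andbT eq_sym; apply/negP => /eqP pt; exact: nt.
have [/set_mem|_] := boolP (t \in _); last by rewrite mulr0 invr_ge0.
rewrite /= in_itv /= mulr1 => /andP[g1 g2].
have u0 : 0 <= t - t0 by rewrite subr_ge0.
rewrite lef_pV2 ?posrE ?mulr_gt0 ?exprn_gt0//.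
rewrite pE; have -> : t = t0 + (t - t0) by rewrite addrC subrK.
apply: (le_trans (pK _)); rewrite ler_pM2l// lerXn2r ?nnegrE ?(ltW d0)//.
by rewrite lerBlDl ltW.
Qed.
End boundary_p.

Lemma mono_nat_ge (f : nat -> nat) :
  (forall a b, (f a <= f b)%N = (a <= b)%N) -> forall j, (j <= f j)%N.
Proof.
move=> fm; elim=> // j jh; apply: leq_ltn_trans jh _.
by rewrite ltnNge fm -ltnNge.
Qed.

Lemma cvg_mono_nat (f : nat -> nat) :
  (forall a b, (f a <= f b)%N = (a <= b)%N) -> f @ \oo --> \oo.
Proof.
move=> fm A [N _ NA]; exists N => // j /= Nj; apply: NA.
exact: leq_trans Nj (mono_nat_ge fm j).
Qed.

(** Induction on the coordinates: each step refines the previous subsequence, which keeps the limits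
    already obtained. *)
Lemma bolzano_weierstrass_seq (R : realType) (I : eqType) (r : seq I) (u : I -> nat -> R) :
  (forall i, i \in r -> exists M, forall j, `|u i j| <= M) ->
  exists2 f : nat -> nat, (forall a b, (f a <= f b)%N = (a <= b)%N)
    & forall i, i \in r -> cvgn (u i \o f).
Proof.
elim: r => [|i r ih] H; first by exists id.
have [|f fm fc] := ih; first by move=> k kr; apply: H; rewrite in_cons kr orbT.
have [M HM] := H i (mem_head _ _).
have [|g gm gc] := @bolzano_weierstrass R (u i \o f).
  exists M; split; first exact: num_real.
  by move=> x Mx j _ /=; apply: le_trans (ltW Mx).
exists (f \o g); first by move=> a b; rewrite /= fm; exact: gm.
move=> k; rewrite in_cons => /orP[/eqP ->|kr]; first exact: gc.
have /cvg_ex[l ul] := fc k kr; apply/cvg_ex; exists l.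
rewrite -[X in X @ _]/((u k \o f) \o g).
exact: cvg_comp (cvg_mono_nat gm) ul.
Qed.


Lemma psd_scale (R : realType) (m : nat) (M : 'M[R[i]]_m) (c : R) :
  0 <= c -> psd M -> psd (real_complex R c *: M).
Proof.
move=> c0 [hM pM]; split.
  move=> a b; rewrite !mxE rmorphM /= hM.
  by congr (_ * _); exact/esym/conjc_real.
by move=> x; rewrite -scalemxAr -scalemxAl mxE mulr_ge0 ?ler0c.
Qed.

(** * Moments of the spectral density and coercivity of the trace term *)

Section moments.
Variable R : realType.
Local Notation C := R[i].
Local Notation rC := (real_complex R).
Local Notation mu := (@lebesgue_measure R).
Local Notation T := (@Tset R).
Variables m n : nat.
Variables (Rk : nat -> 'M[R]_m) (Phi : R -> 'M[C]_m).
Hypothesis hPhi : admissible_psd n Rk Phi.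
Implicit Types (Q : nat -> 'M[R]_m).

Definition moment (k : nat) a b (t : R) : R := complex.Re (Phi t a b * expi (k%:R * t)).

Definition pairing Q (t : R) : R :=
  \sum_(k < n.+1) \sum_a \sum_b Q k a b * moment k a b t.

(** Hermitian symmetry of [Phi] turns the [e^(-ikt)] terms with exchanged indices into the same real
    moments, so both halves of [Q] contribute equally and the factor 1/2 disappears. *)
Lemma pairingE Q t : psd (Phi t) ->
  pairing Q t = complex.Re (\sum_a \sum_b (Qeval n Q t a b)^* * Phi t a b).
Proof.
move=> [hP _].
have conjR (r : R) : (rC r)^* = rC r by exact: conjc_real.
have ReZ (r : R) (z : C) : complex.Re (rC r * z) = r * complex.Re z.
  by case: z => z1 z2 /=; ring.
have half : 2^-1 = rC 2^-1 by rewrite rmorphV ?unitfE// rmorph_nat.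
have swap k a b : complex.Re (Phi t b a * expi (- (k%:R * t))) = moment k a b t.
  by rewrite /moment hP -conj_expi -rmorphM; case: (Phi t a b * _).
rewrite Re_sum; under [RHS]eq_bigr => a _ do rewrite Re_sum.
have E a b : complex.Re ((Qeval n Q t a b)^* * Phi t a b) =
    Q 0%N a b * moment 0 a b t
    + 2^-1 * \sum_(1 <= k < n.+1) (Q k a b * moment k a b t + Q k b a * moment k b a t).
  have -> : (Qeval n Q t a b)^* = rC (Q 0%N a b) + rC 2^-1 *
      \sum_(1 <= k < n.+1) (rC (Q k a b) * expi (k%:R * t) + rC (Q k b a) * expi (- (k%:R * t))).
    apply: etrans (congr1 Num.conj (QevalE n Q t a b)) _.
    rewrite half rmorphD rmorphM rmorph_sum /= !conjR; congr (_ + _ * _).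
    apply: eq_bigr => k _; rewrite rmorphD !rmorphM /= !conjR !conj_expi opprK.
    by rewrite mulrC [X in _ + X]mulrC.
  rewrite mulrDl ReD ReZ {1}/moment mul0r expi0 mulr1; congr (_ + _).
  rewrite -mulrA ReZ; congr (_ * _).
  rewrite mulr_suml Re_sum; apply: eq_bigr => k _.
  rewrite mulrDl ReD -!mulrA !ReZ; congr (_ * _ + _ * _); first by rewrite mulrC.
  by rewrite mulrC swap.
under [RHS]eq_bigr => a _ do under eq_bigr => b _ do rewrite E.
under [RHS]eq_bigr => a _ do rewrite big_split /= -mulr_sumr.
rewrite big_split /= -mulr_sumr /pairing big_ord_recl /=; congr (_ + _).
rewrite -(big_mkord predT (fun k => \sum_a \sum_b Q k.+1 a b * moment k.+1 a b t)).
under [in RHS]eq_bigr => a _ do rewrite exchange_big /=.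
rewrite [in RHS]exchange_big /= big_add1 /= mulr_sumr; apply: eq_bigr => k _.
under [in RHS]eq_bigr => a _ do rewrite big_split /=.
rewrite big_split /= [X in _ + X]exchange_big /=.
by rewrite -mulr2n -mulr_natr; field.
Qed.

Lemma integrable_moment k a b : mu.-integrable T (EFin \o moment k a b).
Proof.
have [hi _] := hPhi; have [iR iI] := hi a b.
have cM : continuous (fun x : R => k%:R * x).
  by move=> t; apply: cvgM; [exact: cvg_cst|exact: cvg_id].
have cc : continuous (fun t : R => cos (k%:R * t)).
  by move=> t; apply: continuous_comp; [exact: cM|exact: continuous_cos].
have cs : continuous (fun t : R => sin (k%:R * t)).
  by move=> t; apply: continuous_comp; [exact: cM|exact: continuous_sin].
have mT := @measurable_Tset R.
have -> : EFin \o moment k a b =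
  (((EFin \o (fun t => cos (k%:R * t))) \* (fun t => (complex.Re (Phi t a b))%:E))
   \- ((EFin \o (fun t => sin (k%:R * t))) \* (fun t => (complex.Im (Phi t a b))%:E)))%E.
  apply/funext => t; rewrite /moment /= -!EFinM -EFinB; congr (_%:E).
  by case: (Phi t a b) => z1 z2 /=; ring.
apply: integrableB => //; apply: integrableMr => //.
- exact: continuous_measurable_Tset.
- exists 1; split; first exact: num_real.
  by move=> M M1 t _ /=; apply: le_trans (cos_max _) (ltW M1).
- exact: continuous_measurable_Tset.
- exists 1; split; first exact: num_real.
  by move=> M M1 t _ /=; apply: le_trans (sin_max _) (ltW M1).
Qed.

Lemma integral_moment k a b : (k <= n)%N ->
  (\int[mu]_(t in T) (moment k a b t)%:E = (2 * pi * Rk k a b)%:E)%E.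
Proof.
move=> kn; have [_ [_ [_ hR]]] := hPhi; have [+ _] := hR k kn a b.
rewrite /intT -/(moment k a b _).
(* Finiteness allows the factor [(2 pi)^-1] to be cancelled in the extended reals. *)
have : (\int[mu]_(t in T) (moment k a b t)%:E)%E \is a fin_num.
  by apply: integrable_fin_num; [exact: measurable_Tset|exact: integrable_moment].
move=> /fineK; set I := fine _; rewrite /moment => <-.
rewrite -EFinM => -[<-]; congr (_%:E).
by rewrite mulrA mulfV ?mul1r// gt_eqF// pi2_gt0.
Qed.

Definition trace_pairing Q : R := \sum_(0 <= k < n.+1) \tr ((Q k)^T *m Rk k).

Lemma trace_pairingE Q :
  trace_pairing Q = \sum_(k < n.+1) \sum_a \sum_b Q k a b * Rk k a b.
Proof.
rewrite /trace_pairing big_mkord; apply: eq_bigr => k _.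
rewrite /mxtrace exchange_big /=; apply: eq_bigr => b _.
by rewrite mxE; apply: eq_bigr => a _; rewrite mxE.
Qed.

Lemma integrable_pairing Q : mu.-integrable T (EFin \o pairing Q).
Proof.
have mT := @measurable_Tset R.
have -> : EFin \o pairing Q = (fun t => \sum_(k < n.+1) \sum_a \sum_b
    ((Q k a b)%:E * (moment k a b t)%:E))%E.
  apply/funext => t; rewrite /pairing /= -sumEFin; apply: eq_bigr => k _.
  by rewrite -sumEFin; apply: eq_bigr => a _; rewrite -sumEFin.
apply: integrable_sum => // k _; apply: integrable_sum => // a _.
apply: integrable_sum => // b _; apply: integrableZl => //.
exact: integrable_moment.
Qed.

Lemma integral_pairing Q :
  (\int[mu]_(t in T) (pairing Q t)%:E = (2 * pi * trace_pairing Q)%:E)%E.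
Proof.
have mT := @measurable_Tset R.
have i3 k a b : mu.-integrable T (fun t => (Q k a b)%:E * (moment k a b t)%:E)%E.
  by apply: integrableZl => //; exact: integrable_moment.
have i2 k a : mu.-integrable T (fun t => \sum_b (Q k a b)%:E * (moment k a b t)%:E)%E.
  by apply: integrable_sum.
have i1 (k : nat) : mu.-integrable T (fun t => \sum_a \sum_b (Q k a b)%:E * (moment k a b t)%:E)%E.
  by apply: integrable_sum.
transitivity (\int[mu]_(t in T) (\sum_(k < n.+1) \sum_a \sum_b
    ((Q k a b)%:E * (moment k a b t)%:E)))%E.
  apply: eq_integral => t _; rewrite /pairing /= -sumEFin; apply: eq_bigr => k _.
  by rewrite -sumEFin; apply: eq_bigr => a _; rewrite -sumEFin.
rewrite trace_pairingE mulr_sumr -sumEFin integral_sum//; apply: eq_bigr => k _.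
rewrite mulr_sumr -sumEFin integral_sum//; apply: eq_bigr => a _.
rewrite mulr_sumr -sumEFin integral_sum//; apply: eq_bigr => b _.
rewrite integralZl//; last exact: integrable_moment.
rewrite integral_moment; last by rewrite -ltnS.
by rewrite -EFinM mulrCA.
Qed.

(** If the integral were zero, the nonnegative pairing would vanish almost everywhere. The interval
    on which [Phi] is positive definite would then be covered by a null set and the finitely many
    zeros of [Q]. *)
Lemma trace_pairing_gt0 Q k a b : Pm n Q -> (k <= n)%N -> Q k a b != 0 ->
  0 < trace_pairing Q.
Proof.
move=> [_ pQ] kn Qn0; have [_ [psdP [[x [y [x0 [xy [y2 pdP]]]]] _]]] := hPhi.
have mT := @measurable_Tset R.
have w0 t : T t -> 0 <= pairing Q t.
  move=> Tt; rewrite pairingE; last exact: psdP.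
  by have := psd_pairing (pQ t) (psdP t Tt); rewrite lecE => /andP[].
have w1 t : T t -> x < t < y -> Qeval n Q t != 0 -> 0 < pairing Q t.
  move=> Tt txy Qt; rewrite pairingE; last exact: psdP.
  by have := posdef_pairing (pQ t) (pdP t txy) Qt; rewrite ltcE => /andP[].
have I0 : (0 <= \int[mu]_(t in T) (pairing Q t)%:E)%E.
  by apply: integral_ge0 => t Tt; rewrite lee_fin w0.
have := I0; rewrite integral_pairing lee_fin pmulr_rge0 ?pi2_gt0//.
rewrite le_eqVlt => /orP[/eqP tp0|//]; exfalso.
have mp : measurable_fun T (EFin \o pairing Q) by have /integrableP[] := integrable_pairing Q.
have : (\int[mu]_(t in T) `|(EFin \o pairing Q) t| = 0)%E.
  transitivity (\int[mu]_(t in T) (pairing Q t)%:E)%E.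
    apply: eq_integral => t /set_mem Tt /=; rewrite ger0_norm//; exact: w0.
  by rewrite integral_pairing -tp0 mulr0.
move=> /(ae_eq_integral_abs mu mT mp) [N [mN N0 NP]].
pose Z := [set t | T t /\ Qeval n Q t = 0].
have Zf : finite_set Z by exact: finite_Qeval_eq0 kn Qn0.
have mZ : measurable Z.
  by apply: countable_measurable => //; exact: finite_set_countable.
have Z0 : mu Z = 0%E by apply: countable_lebesgue_measure0; exact: finite_set_countable.
have sub : `]x, y[ `<=` N `|` Z.
  move=> t /=; rewrite in_itv /= => txy.
  have Tt : T t.
    move: txy => /andP[xt ty]; rewrite /Tset /= in_itv /=; apply/andP; split.
      exact: le_trans x0 (ltW xt).
    exact: lt_le_trans ty y2.
  have [Qt|Qt] := eqVneq (Qeval n Q t) 0; first by right.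
  left; apply: NP => /= /(_ Tt) [] /eqP; apply/negP.
  by rewrite gt_eqF// w1.
have : (mu (`]x, y[%classic : set R) <= mu (N `|` Z))%E.
  apply: le_measure; rewrite ?inE//; exact: measurableU.
have -> : mu (N `|` Z) = 0%E by apply: null_set_setU.
have := lebesgue_measure_itv `]x, y[%R; rewrite /= lte_fin xy => ->.
by rewrite -EFinD lee_fin subr_le0 leNgt xy.
Qed.

Lemma coef_norm_eq0 Q : coef_norm n Q = 0 -> forall k a b, (k <= n)%N -> Q k a b = 0.
Proof.
move=> N0 k a b kn; apply/eqP; rewrite -normr_le0 -N0 /coef_norm.
rewrite (bigD1 (Ordinal (kn : (k < n.+1)%N)))//= -[leLHS]addr0 lerD//; last first.
  by rewrite sumr_ge0// => i _; rewrite sumr_ge0// => c _; rewrite sumr_ge0.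
rewrite (bigD1 a)//= -[leLHS]addr0 lerD//; last first.
  by rewrite sumr_ge0// => c _; rewrite sumr_ge0.
by rewrite (bigD1 b)//= lerDl sumr_ge0.
Qed.

Lemma le_coef_norm Q k a b : (k <= n)%N -> `|Q k a b| <= coef_norm n Q.
Proof.
move=> kn; rewrite /coef_norm.
rewrite (bigD1 (Ordinal (kn : (k < n.+1)%N)))//= -[leLHS]addr0 lerD//; last first.
  by rewrite sumr_ge0// => i _; rewrite sumr_ge0// => c _; rewrite sumr_ge0.
rewrite (bigD1 a)//= -[leLHS]addr0 lerD//; last first.
  by rewrite sumr_ge0// => c _; rewrite sumr_ge0.
by rewrite (bigD1 b)//= lerDl sumr_ge0.
Qed.

Lemma Pm_scale Q (c : R) : 0 <= c -> Pm n Q -> Pm n (fun k => c *: Q k).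
Proof.
move=> c0 [Q0 pQ].
have E t : Qeval n (fun k => c *: Q k) t = rC c *: Qeval n Q t.
  apply/matrixP => a b; apply: etrans (QevalE _ _ _ _ _) _.
  rewrite [RHS]mxE (QevalE n Q t a b) mulrDr; congr (_ + _); first by rewrite mxE rmorphM.
  rewrite mulrCA; congr (_ * _); rewrite mulr_sumr; apply: eq_bigr => k _.
  by rewrite !mxE !rmorphM /=; ring.
split; first by rewrite linearZ /= Q0.
by move=> t; rewrite E; exact: psd_scale.
Qed.

Lemma trace_pairing_coercive :
  exists2 nu : R, 0 < nu & forall Q, Pm n Q -> nu * coef_norm n Q <= trace_pairing Q.
Proof.
apply: contrapT => H.
have /choice [Qs QsP] : forall j : nat, exists Q, Pm n Q /\
    trace_pairing Q < j.+1%:R^-1 * coef_norm n Q.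
  move=> j; apply: contrapT => Hj; apply: H; exists j.+1%:R^-1 => [|Q QP].
    by rewrite invr_gt0.
  by rewrite leNgt; apply/negP => h; apply: Hj; exists Q.
(* The strict inequality excludes norm zero, where the trace pairing vanishes too. *)
have N0 j : 0 < coef_norm n (Qs j).
  rewrite lt_neqAle coef_norm_ge0 andbT eq_sym; apply/negP => /eqP z.
  have [_] := QsP j; rewrite z mulr0 trace_pairingE big1 ?ltxx// => k _.
  rewrite big1// => a _; rewrite big1// => b _.
  by rewrite (coef_norm_eq0 z) ?mul0r// -ltnS.
(* The normalized counterexamples have a limit point in [Pm] of norm 1 with nonpositive trace
   pairing, against [trace_pairing_gt0]. *)
pose q j k := (coef_norm n (Qs j))^-1 *: Qs j k.
have qP j : Pm n (q j).
  by apply: Pm_scale (QsP j).1; rewrite invr_ge0 ltW.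
have qle j k a b : (k <= n)%N -> `|q j k a b| <= 1.
  move=> kn; rewrite /q mxE normrM ger0_norm ?invr_ge0 ?(ltW (N0 j))//.
  by rewrite mulrC ler_pdivrMr// mul1r le_coef_norm.
pose u (i : 'I_n.+1 * 'I_m * 'I_m) j := q j i.1.1 i.1.2 i.2.
have [|f fm fc] := @bolzano_weierstrass_seq R _ (enum [the finType of ('I_n.+1 * 'I_m * 'I_m)%type]) u.
  by move=> i _; exists 1 => j; apply: qle; rewrite -ltnS.
pose Q k : 'M[R]_m := \matrix_(a, b) limn (fun j => q (f j) k a b).
have qQ k a b : (k <= n)%N -> (fun j => q (f j) k a b) @ \oo --> Q k a b.
  move=> kn; have := fc (Ordinal (kn : (k < n.+1)%N), a, b); rewrite mem_enum => /(_ isT).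
  by rewrite mxE.
have QP : Pm n Q by apply: cvg_Pm qQ => j; exact: qP.
have Nq j : coef_norm n (q j) = 1.
  have -> : coef_norm n (q j) = (coef_norm n (Qs j))^-1 * coef_norm n (Qs j).
    rewrite /coef_norm mulr_sumr; apply: eq_bigr => k _.
    rewrite mulr_sumr; apply: eq_bigr => a _; rewrite mulr_sumr; apply: eq_bigr => b _.
    by rewrite mxE normrM ger0_norm// invr_ge0 ltW// N0.
  by rewrite mulVf// gt_eqF.
have QN : coef_norm n Q = 1.
  have c1 : (fun _ : nat => 1 : R) @ \oo --> (1 : R) by exact: cvg_cst.
  apply: (cvg_unique (@Rhausdorff R) _ c1).
  rewrite [X in X @ _](_ : _ = (fun j => coef_norm n (q (f j)))); last first.
    by apply/funext => j; rewrite Nq.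
  apply: cvg_sum_seq => k _; apply: cvg_sum_seq => a _; apply: cvg_sum_seq => b _.
  by apply: cvg_norm; apply: qQ; rewrite -ltnS.
have tr0 : 0 <= - trace_pairing Q.
  have cv : (fun j => j.+1%:R^-1 - trace_pairing (q (f j))) @ \oo --> 0 - trace_pairing Q.
    apply: cvgB; first exact: cvg_harmonic.
    rewrite trace_pairingE; under eq_fun do rewrite trace_pairingE.
    apply: cvg_sum_seq => k _; apply: cvg_sum_seq => a _; apply: cvg_sum_seq => b _.
    by apply: cvgM; [apply: qQ; rewrite -ltnS|exact: cvg_cst].
  rewrite -sub0r; apply: cvg_ge0 cv _ => j; rewrite subr_ge0.
  have tq : trace_pairing (q (f j)) = (coef_norm n (Qs (f j)))^-1 * trace_pairing (Qs (f j)).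
    rewrite !trace_pairingE mulr_sumr; apply: eq_bigr => k _.
    rewrite mulr_sumr; apply: eq_bigr => a _; rewrite mulr_sumr; apply: eq_bigr => b _.
    by rewrite mxE mulrA.
  rewrite tq mulrC ler_pdivrMr//; apply: (le_trans (ltW (QsP (f j)).2)).
  rewrite ler_wpM2r ?(ltW (N0 _))// lef_pV2 ?posrE// ler_nat ltnS.
  exact: mono_nat_ge.
have [[[k a] b] kab] : exists i : 'I_n.+1 * 'I_m * 'I_m, Q i.1.1 i.1.2 i.2 != 0.
  apply/existsP; apply: contraT; rewrite negb_exists => /forallP h.
  have := QN; rewrite /coef_norm big1 => [/esym/eqP|k _]; first by rewrite oner_eq0.
  rewrite big1// => a _; rewrite big1// => b _.
  by have := h (k, a, b); rewrite negbK => /eqP /= ->; rewrite normr0.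
have := trace_pairing_gt0 QP (ltn_ord k : (k <= n)%N) kab.
by move: tr0; rewrite oppr_ge0 leNgt => /negPf ->.
Qed.
End moments.

(** * Elimination of the hyperparameters *)

Section gamma.
Variable R : realType.
Variables m n : nat.
Variable eps : R.
Hypothesis eps0 : 0 < eps.
Implicit Types (Q : nat -> 'M[R]_m) (gam : 'I_m -> 'I_m -> R).

Lemma qjh_ge0 Q j h : 0 <= qjh n Q j h.
Proof. by rewrite /qjh le_max normr_ge0. Qed.

Lemma cvg_maxr (X : Type) (F : set_system X) (FF : Filter F) (f g : X -> R) (a b : R) :
  f @ F --> a -> g @ F --> b -> (fun x => Num.max (f x) (g x)) @ F --> Num.max a b.
Proof.
move=> fa gb; rewrite maxr_absE; under eq_fun do rewrite maxr_absE.
apply: cvgM; last exact: cvg_cst.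
by apply: cvgD; [exact: cvgD|apply: cvg_norm; exact: cvgB].
Qed.

Lemma cvg_qjh (s : nat -> nat -> 'M[R]_m) Q (j h : 'I_m) :
  (forall k a b, (k <= n)%N -> (fun i => s i k a b) @ \oo --> Q k a b) ->
  (fun i => qjh n (s i) j h) @ \oo --> qjh n Q j h.
Proof.
move=> sQ; rewrite /qjh; apply: cvg_maxr; first by apply: cvg_norm; exact: sQ.
have : forall k, k \in index_iota 1 n.+1 -> (k <= n)%N by move=> k; rewrite mem_index_iota => /andP[].
elim: (index_iota 1 n.+1) => [|k r ih] H.
  by rewrite big_nil; under eq_fun do rewrite big_nil; exact: cvg_cst.
rewrite big_cons; under eq_fun do rewrite big_cons.
apply: cvg_maxr; last by apply: ih => i ir; apply: H; rewrite in_cons ir orbT.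
by apply: cvg_maxr; apply: cvg_norm; apply: sQ; apply: H; rewrite mem_head.
Qed.

Lemma qjh_shift Q s j h : 0 <= s -> qjh n (shift Q s) j h <= qjh n Q j h + s.
Proof.
move=> s0; rewrite /qjh /shift /= ge_max; apply/andP; split.
  apply: (@le_trans _ _ (`|Q 0%N j h| + s)).
    rewrite !mxE; apply: (le_trans (ler_normD _ _)); rewrite lerD2l.
    by case: (j == h); rewrite ?mulr1n ?mulr0n ?normr0// ger0_norm.
  by rewrite lerD2r le_max lexx.
rewrite -[leLHS]addr0 lerD//.
rewrite [leLHS](eq_big_nat _ _ (F2 := fun k => Num.max `|Q k j h| `|Q k h j|)); last by case.
by rewrite le_max lexx orbT.
Qed.

(** The number of coefficients compared in [q_jh]: one from [Q_0], and from each later [Q_k] one on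
    the diagonal or two off it. It merges the two logarithmic sums. *)
Definition weight (j h : 'I_m) : R := if h == j then (n + 1)%:R else (2 * n + 1)%:R.

Lemma weight_gt0 j h : 0 < weight j h.
Proof. by rewrite /weight; case: ifP => _; rewrite ltr0n addn1. Qed.

(** Kept literally equal to the last summand of [ell], so that [ellE] holds by conversion. *)
Definition penalty gam Q : R := hW n gam Q
      - \sum_(j < m) \sum_(h < m | (h < j)%N) (2 * n + 1)%:R * ln (gam j h)
      - \sum_(j < m) (n + 1)%:R * ln (gam j j)
      + \sum_(j < m) \sum_(h < m | (h <= j)%N) eps * gam j h.

Lemma penaltyE gam Q : penalty gam Q =
  \sum_(j < m) \sum_(h < m | (h <= j)%N)
    (gam j h * (qjh n Q j h + eps) - weight j h * ln (gam j h)).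
Proof.
rewrite /penalty /hW -!sumrB -big_split /=; apply: eq_bigr => j _.
rewrite [in RHS]sumrB.
have -> : \sum_(h < m | (h <= j)%N) gam j h * (qjh n Q j h + eps) =
   \sum_(h < m | (h <= j)%N) gam j h * qjh n Q j h + \sum_(h < m | (h <= j)%N) eps * gam j h.
  by rewrite -big_split /=; apply: eq_bigr => h _; ring.
have -> : \sum_(h < m | (h <= j)%N) weight j h * ln (gam j h) =
  \sum_(h < m | (h < j)%N) (2 * n + 1)%:R * ln (gam j h) + (n + 1)%:R * ln (gam j j).
  rewrite (bigD1 j)//= addrC /weight eqxx; congr (_ + _).
  apply: eq_big => h; first by rewrite ltn_neqAle andbC.
  by move=> /andP[_ /negPf ->].
ring.
Qed.

(* The minimizer of [g * (q + eps) - weight * ln g] over [g > 0]. *)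
Definition gam_opt Q j h : R := weight j h / (qjh n Q j h + eps).

Lemma gam_opt_gt0 Q j h : 0 < gam_opt Q j h.
Proof. by rewrite divr_gt0 ?weight_gt0// ltr_wpDl// qjh_ge0. Qed.

Definition penalty_min Q : R := \sum_(j < m) \sum_(h < m | (h <= j)%N)
    (weight j h - weight j h * ln (gam_opt Q j h)).

Lemma penalty_opt Q : penalty (gam_opt Q) Q = penalty_min Q.
Proof.
rewrite penaltyE; apply: eq_bigr => j _; apply: eq_bigr => h _; congr (_ - _).
by rewrite /gam_opt divfK// gt_eqF// ltr_wpDl// qjh_ge0.
Qed.

(** With [s = q_jh + eps] and weight [d], each term is [d] times the inequality [ln z <= z - 1] at
    [z = y s / d], where [y] is the hyperparameter. *)
Lemma penalty_min_le gam Q : (forall j h : 'I_m, (h <= j)%N -> 0 < gam j h) ->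
  penalty_min Q <= penalty gam Q.
Proof.
move=> g0; rewrite penaltyE; apply: ler_sum => j _; apply: ler_sum => h hj.
set s := qjh n Q j h + eps.
have s0 : 0 < s by rewrite ltr_wpDl// qjh_ge0.
have d0 := weight_gt0 j h; have y0 := g0 j h hj.
have -> : gam_opt Q j h = weight j h / s by [].
move: (weight j h) (gam j h) d0 y0 => d y d0 y0.
have z0 : 0 < y * s / d by rewrite divr_gt0// mulr_gt0.
have := ln_le_sub1 z0.
rewrite ln_div ?posrE ?mulr_gt0// lnM ?posrE//.
rewrite ln_div ?posrE//.
move=> /(ler_wpM2l (ltW d0)); rewrite (mulrBr d (_ / _)) mulr1 (mulrC d (_ / _)).
rewrite divfK ?gt_eqF//; lra.
Qed.

(** Since [q_jh >= 0], the optimal hyperparameter is at most [weight / eps]. *)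
Lemma penalty_min_bounded Q : \sum_(j < m) \sum_(h < m | (h <= j)%N)
    (weight j h - weight j h * ln (weight j h / eps)) <= penalty_min Q.
Proof.
apply: ler_sum => j _; apply: ler_sum => h _.
rewrite lerD2l lerN2 ler_pM2l ?weight_gt0// ler_ln ?posrE ?gam_opt_gt0 ?divr_gt0 ?weight_gt0//.
by rewrite ler_pM2l ?weight_gt0// lef_pV2 ?posrE ?ltr_wpDl ?qjh_ge0// lerDr qjh_ge0.
Qed.

Lemma cvg_penalty_min (s : nat -> nat -> 'M[R]_m) Q :
  (forall k a b, (k <= n)%N -> (fun i => s i k a b) @ \oo --> Q k a b) ->
  (fun i => penalty_min (s i)) @ \oo --> penalty_min Q.
Proof.
move=> sQ.
have E (r : seq 'I_m) (P : pred 'I_m) (F : 'I_m -> R) :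
  \sum_(h <- r | P h) F h = \sum_(h <- [seq h <- r | P h]) F h by rewrite big_filter.
rewrite /penalty_min; apply: cvg_sum_seq => j _.
rewrite E; under eq_fun do rewrite E.
apply: cvg_sum_seq => h _; apply: cvgB; first exact: cvg_cst.
apply: cvgM; first exact: cvg_cst.
apply: continuous_cvg; first exact: continuous_ln (gam_opt_gt0 _ _ _).
apply: cvgM; first exact: cvg_cst.
apply: cvgV; first by rewrite gt_eqF// ltr_wpDl// qjh_ge0.
by apply: cvgD; [exact: cvg_qjh|exact: cvg_cst].
Qed.

(** With [gam] held fixed the logarithms cancel, and each [q_jh] grows by at most [s]. *)
Lemma penalty_shift gam Q s : (forall j h : 'I_m, (h <= j)%N -> 0 < gam j h) -> 0 <= s ->
  penalty gam (shift Q s) <=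
  penalty gam Q + s * \sum_(j < m) \sum_(h < m | (h <= j)%N) gam j h.
Proof.
move=> g0 s0; rewrite !penaltyE mulr_sumr -big_split /=; apply: ler_sum => j _.
rewrite mulr_sumr -big_split /=; apply: ler_sum => h hj.
have := ler_wpM2l (ltW (g0 j h hj)) (@qjh_shift Q s j h s0).
rewrite !mulrDr (mulrC s).
move: (gam j h * _) (gam j h * _) (gam j h * s) (gam j h * eps) (weight j h * _).
move=> a b u v w; lra.
Qed.
End gamma.

(** * Pointwise limits of the logarithmic integrand *)

Section pointwise_limits.
Variable R : realType.
Variables m n : nat.
Local Notation detQ Q t := (complex.Re (\det (Qeval n Q t))).
Variables (ps : nat -> nat -> R) (Qs : nat -> nat -> 'M[R]_m).
Variables (p : nat -> R) (Q : nat -> 'M[R]_m).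
Hypothesis psB : forall j, Bo n (ps j).
Hypothesis QsB : forall j, Bm n (Qs j).
Hypothesis psp : forall k, (k <= n)%N -> (fun j => ps j k) @ \oo --> p k.
Hypothesis QsQ : forall k a b, (k <= n)%N -> (fun j => Qs j k a b) @ \oo --> Q k a b.
Variable t : R.
Hypothesis pt : 0 < peval n p t.

Let cp : (fun j => peval n (ps j) t) @ \oo --> peval n p t.
Proof. exact: cvg_peval psp. Qed.

Let cD : (fun j => detQ (Qs j) t) @ \oo --> detQ Q t.
Proof. by have [] := ccvg_det (@ccvg_Qeval _ _ _ _ _ n Qs Q t QsQ). Qed.

Let D0 j : 0 < detQ (Qs j) t.
Proof. by have := posdef_det ((QsB j).2 t); rewrite ltcE => /andP[]. Qed.

Let integrandsE : (fun j => integrand n (ps j) (Qs j) t) = (fun j =>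
  m%:R * (peval n (ps j) t * ln (peval n (ps j) t) - peval n (ps j) t)
  - peval n (ps j) t * ln (detQ (Qs j) t)).
Proof.
apply/funext => j; rewrite integrand_regular//; first exact: posdef_psd ((QsB j).2 t).
exact: ltW ((psB j).2 t).
Qed.

Lemma cvg_integrand : 0 < detQ Q t ->
  (fun j => integrand n (ps j) (Qs j) t) @ \oo --> integrand n p Q t.
Proof.
move=> DQ.
have pQ : psd (Qeval n Q t).
  by have [] := cvg_Pm (fun j => Bm_Pm (QsB j)) QsQ.
rewrite integrandsE (integrand_regular pQ (ltW pt) DQ).
have clp : (fun j => ln (peval n (ps j) t)) @ \oo --> ln (peval n p t).
  by apply: continuous_cvg cp; exact: continuous_ln.
have clD : (fun j => ln (detQ (Qs j) t)) @ \oo --> ln (detQ Q t).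
  by apply: continuous_cvg cD; exact: continuous_ln.
apply: cvgB; last exact: cvgM.
by apply: cvgM; [exact: cvg_cst|apply: cvgB => //; exact: cvgM].
Qed.

Lemma integrand_diverges : detQ Q t = 0 ->
  forall M, \forall j \near \oo, M <= integrand n (ps j) (Qs j) t.
Proof.
move=> DQ M; pose r := peval n p t / 2.
have r0 : 0 < r by rewrite divr_gt0.
(* Eventually [p >= r] and [- ln det >= L], so the logarithmic term is at least [|M| + m]. The [m]
   absorbs the lower bound [- m] of the remaining part. *)
pose L := (`|M| + m%:R) / r.
have L0 : 0 <= L by rewrite divr_ge0 ?addr_ge0// ltW.
have rL : r * L = `|M| + m%:R by rewrite mulrC divfK// gt_eqF.
have nD : \forall j \near \oo, detQ (Qs j) t < expR (- L).
  have cD0 := eq_rect _ (fun l : R => (fun j => detQ (Qs j) t) @ \oo --> l) cD _ DQ.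
  by move: cD0 => /cvgr_lt; apply; exact: expR_gt0.
have np : \forall j \near \oo, r < peval n (ps j) t.
  by move: cp => /cvgr_gt; apply; rewrite /r; move: pt; lra.
near=> j.
have -> : integrand n (ps j) (Qs j) t =
  m%:R * (peval n (ps j) t * ln (peval n (ps j) t) - peval n (ps j) t)
  - peval n (ps j) t * ln (detQ (Qs j) t) by exact: (congr1 (fun f => f j) integrandsE).
have dj : ln (detQ (Qs j) t) <= - L.
  rewrite -[leRHS]expRK ler_ln ?posrE ?expR_gt0// ltW//; near: j; exact: nD.
have pj : r <= peval n (ps j) t by apply: ltW; near: j; exact: np.
have := xlnx_lower (ltW ((psB j).2 t)).
move: (ln (detQ _ _)) (peval n (ps j) t) dj pj => d y dj pj xl.
have h1 : m%:R * -1 <= m%:R * (y * ln y - y) by rewrite ler_wpM2l.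
have h2 : r * L <= y * - d by apply: ler_pM => //; [exact: ltW|rewrite lerNr].
have h3 := ler_norm M.
rewrite rL mulrN in h2; rewrite mulrN1 in h1.
move: h1 h2 h3; move: (`|M|) (m%:R * _) (y * d) => u v w; lra.
Unshelve. all: by end_near. Qed.
End pointwise_limits.

(** * The objective *)

Section objective.
Variable R : realType.
Local Notation C := R[i].
Local Notation rC := (real_complex R).
Local Notation mu := (@lebesgue_measure R).
Local Notation T := (@Tset R).
Variables (m n N : nat) (Rk : nat -> 'M[R]_m) (c : nat -> R) (alpha lam eps kappa : R).
Hypotheses (N0 : (0 < N)%N) (alpha0 : 0 < alpha) (lam0 : 0 < lam) (eps0 : 0 < eps).
Implicit Types (p : nat -> R) (Q : nat -> 'M[R]_m) (gam : 'I_m -> 'I_m -> R).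
Implicit Types (x y : R) (X Y : \bar R).

Let A := N%:R / (2 * alpha).
Let A_gt0 : 0 < A. Proof. by rewrite divr_gt0 ?ltr0n// mulr_gt0. Qed.
Let w := (2 * pi : R)^-1.
Let w_gt0 : 0 < w. Proof. by rewrite invr_gt0 pi2_gt0. Qed.

Definition intlog p Q : \bar R := (\int[mu]_(t in T) (integrand n p Q t)%:E)%E.
Definition intinv p : \bar R := (\int[mu]_(t in T) ((peval n p t)^-1)%:E)%E.

(* [X] and [Y] stand for the integrals of the logarithmic term and of [1/p]. *)
Definition evalue X Y p Q gam : \bar R :=
  (A%:E * (w%:E * X + (trace_pairing n Rk Q)%:E - (\sum_(0 <= k < n.+1) p k * c k)%:E)
   + kappa%:E + lam%:E * (w%:E * Y) + (penalty n eps gam Q)%:E)%E.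

Definition rvalue x y p Q z : R :=
  A * (w * x + trace_pairing n Rk Q - \sum_(0 <= k < n.+1) p k * c k)
  + kappa + lam * (w * y) + z.

Lemma ellE p Q gam :
  ell n N Rk c kappa lam eps p Q alpha gam = evalue (intlog p Q) (intinv p) p Q gam.
Proof. by []. Qed.

Lemma evalue_fin x y p Q gam :
  evalue x%:E y%:E p Q gam = (rvalue x y p Q (penalty n eps gam Q))%:E.
Proof. by rewrite /evalue -!(EFinM, EFinD, EFinN). Qed.

Lemma evalue_le X Y X' Y' p Q gam : (X <= X')%E -> (Y <= Y')%E ->
  (evalue X Y p Q gam <= evalue X' Y' p Q gam)%E.
Proof.
move=> XX YY; apply: leeD => //; apply: leeD; last first.
  by apply: lee_wpmul2l; [rewrite lee_fin ltW|apply: lee_wpmul2l => //; rewrite lee_fin ltW].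
apply: leeD => //; apply: lee_wpmul2l; first by rewrite lee_fin ltW.
apply: leeD => //; apply: leeD => //.
by apply: lee_wpmul2l => //; rewrite lee_fin ltW.
Qed.

Lemma evalue_infl Y p Q gam : (0 <= Y)%E -> evalue +oo%E Y p Q gam = +oo%E.
Proof.
move=> Y0; rewrite /evalue gt0_muley ?lte_fin// !addye// gt0_muley ?lte_fin//.
rewrite addye// -ltNye; apply: lt_le_trans (ltNyr 0) _.
by rewrite !mule_ge0// lee_fin ltW.
Qed.

Lemma evalue_infr X p Q gam : (-oo < X)%E -> evalue X +oo%E p Q gam = +oo%E.
Proof.
case: X => [x|_|]//; last by rewrite evalue_infl.
rewrite /evalue -!(EFinM, EFinD, EFinN) gt0_muley ?lte_fin//.
by rewrite gt0_muley ?lte_fin.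
Qed.

Lemma intinv_ge0 p : Po n p -> (0 <= intinv p)%E.
Proof. by move=> [_ p0]; apply: integral_ge0 => t _; rewrite lee_fin invr_ge0. Qed.

Lemma intlog_lower p Q : Po n p -> Pm n Q ->
  ((- integrand_lower n Q * (2 * pi))%:E <= intlog p Q)%E.
Proof.
move=> pP QP; apply: integral_lower_bound.
- exact: integrand_lower_ge0.
- exact: measurable_integrand.
- by move=> t _; exact: integrand_ge pP (QP.2 t).
Qed.

Lemma intlog_fin p Q : Bo n p -> Bm n Q -> intlog p Q \is a fin_num.
Proof. by move=> pB QB; apply: continuous_integral_fin; exact: continuous_integrand. Qed.

Lemma intinv_fin p : Bo n p -> intinv p \is a fin_num.
Proof.
move=> [_ p0]; apply: continuous_integral_fin => t.
by apply: cvgV; [rewrite gt_eqF|exact: continuous_peval].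
Qed.

Lemma trace_pairing_shift Q s :
  trace_pairing n Rk (shift Q s) = trace_pairing n Rk Q + s * \tr (Rk 0%N).
Proof.
rewrite /trace_pairing !(big_nat_recl _ _ _ (leq0n n)) /=.
rewrite /shift /= linearD /= tr_scalar_mx mulmxDl mxtraceD mul_scalar_mx mxtraceZ.
by rewrite addrAC.
Qed.

Lemma ell_boundary_p p Q gam : Po n p -> ~ Bo n p -> Pm n Q ->
  ell n N Rk c kappa lam eps p Q alpha gam = +oo%E.
Proof.
move=> pP nB QP; rewrite ellE /intinv (integral_inv_boundary pP nB) evalue_infr//.
by apply: lt_le_trans (intlog_lower pP QP); exact: ltNyr.
Qed.

Lemma ell_boundary_Q p Q gam : Bo n p -> Pm n Q ->
  ~ (forall t, \det (Qeval n Q t) = 0) -> ~ Bm n Q ->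
  (forall j h : 'I_m, (h <= j)%N -> 0 < gam j h) ->
  exists s, 0 < s /\ (ell n N Rk c kappa lam eps p (shift Q s) alpha gam
                      < ell n N Rk c kappa lam eps p Q alpha gam)%E.
Proof.
move=> pB QP Q0 nB g0; have [d [s0 [d0 s00 gain]]] := integral_shift_gain pB QP Q0 nB.
have := intinv_fin pB => /fineK; set y := fine _ => yE.
pose G := \sum_(j < m) \sum_(h < m | (h <= j)%N) gam j h.
have G0 : 0 <= G by apply: sumr_ge0 => j _; apply: sumr_ge0 => h hj; exact: ltW (g0 _ _ hj).
(* A bound for the slope in [s] of all other terms: the trace term contributes [A tr R_0], the
   penalty at most [G]. The 1 makes [M] positive. *)
pose M : R := `|A * \tr (Rk 0%N)| + G + 1.
have M0 : 0 < M by rewrite ltr_wpDl// addr_ge0.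
pose e := A * (w * d).
have e0 : 0 < e := mulr_gt0 A_gt0 (mulr_gt0 w_gt0 d0).
(* For the shift [r^2] the gain is [e r] and the cost at most [M r^2]. The bound [r < e / M] lets
   the gain win, and [r^2 < s0] admits the gain estimate. *)
pose r := Num.min (Num.sqrt s0) (e / M) / 2.
have r0 : 0 < r by rewrite divr_gt0// lt_min sqrtr_gt0 s00 divr_gt0.
have r1 : r < Num.sqrt s0.
  apply: (@lt_le_trans _ _ (Num.min (Num.sqrt s0) (e / M))); last by rewrite ge_min lexx.
  by rewrite /r; move: r0; rewrite /r; lra.
have r2 : r * M < e.
  rewrite -ltr_pdivlMr//; apply: (@lt_le_trans _ _ (Num.min (Num.sqrt s0) (e / M))).
    by rewrite /r; move: r0; rewrite /r; lra.
  by rewrite ge_min lexx orbT.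
have rr : 0 < r ^+ 2 < s0.
  rewrite exprn_gt0//= -[ltRHS]sqr_sqrtr ?(ltW s00)//.
  by rewrite !expr2; apply: ltr_pM => //; exact: ltW.
exists (r ^+ 2); split; first by rewrite exprn_gt0.
have {gain} gain : forall s, 0 < s < s0 ->
  (intlog p (shift Q s) + (d * Num.sqrt s)%:E <= intlog p Q)%E := gain.
have := gain _ rr; rewrite sqrtr_sqr (ger0_norm (ltW r0)).
have sB : Bm n (shift Q (r ^+ 2)) by apply: shift_Bm => //; rewrite exprn_gt0.
have := intlog_fin pB sB => /fineK; set b := fine _ => bE.
rewrite !ellE -yE -bE evalue_fin => gn.
(* [intlog p Q] may be +oo here; monotonicity of [evalue] treats both cases alike. *)
have : (evalue (b + d * r)%:E y%:E p Q gam <= evalue (intlog p Q) y%:E p Q gam)%E.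
  by apply: evalue_le => //; rewrite EFinD.
apply: lt_le_trans; rewrite evalue_fin lte_fin /rvalue trace_pairing_shift.
have pen := @penalty_shift _ _ n eps gam Q (r ^+ 2) g0 (ltW (exprn_gt0 2 r0)).
have h1 := ler_norm (A * \tr (Rk 0%N)).
have h2 : r ^+ 2 * M < r * e by rewrite expr2 -mulrA ltr_pM2l.
have h3 : r ^+ 2 * (A * \tr (Rk 0%N)) <= r ^+ 2 * `|A * \tr (Rk 0%N)|.
  by rewrite ler_wpM2l ?sqr_ge0.
have h4 : 0 < r ^+ 2 by rewrite exprn_gt0.
move: pen h2; rewrite -/G /M /e !mulrDr.
move: (penalty _ _ _ _) (penalty _ _ _ _) (\sum_(0 <= k < n.+1) _) (trace_pairing _ _ _).
move=> P1 P2 S1 S2; move: h3 h4.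
move: `|A * \tr (Rk 0%N)| => u; lra.
Qed.

Lemma ln_le_linear (a nu : R) : 0 <= a -> 0 < nu ->
  exists K, forall z, 0 <= z -> a * ln (1 + z) <= nu * z + K.
Proof.
(* [ln y <= y - 1] is used at [y = (1 + z) tau], which gives slope [a tau <= nu]. The denominator is
   [a + 1] because [a] may be 0. *)
move=> a0 nu0; pose tau := nu / (a + 1).
have a1 : 0 < a + 1 by rewrite ltr_wpDl.
have tau0 : 0 < tau by rewrite divr_gt0.
have at_ : a * tau <= nu.
  by rewrite /tau mulrA ler_pdivrMr// mulrC ler_pM2l// lerDl.
exists (nu - a * ln tau) => z z0.
have z1 : 0 < 1 + z by rewrite ltr_pwDl.
have := ln_le_sub1 (mulr_gt0 z1 tau0); rewrite lnM ?posrE// => h.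
have h1 : a * (ln (1 + z) + ln tau) <= a * ((1 + z) * tau).
  by rewrite ler_wpM2l//; apply: le_trans h _; rewrite lerBlDr lerDl.
have h2 : (a * tau) * (1 + z) <= nu * (1 + z) by rewrite ler_wpM2r// ltW.
move: h1 h2; rewrite !mulrDr !mulrDl !mul1r !mulr1; lra.
Qed.

(** Two bounds are needed. Replacing [x] by its lower bound controls the coefficients of [Q] and the
    integral of [1/p]; keeping [x] and discarding the nonnegative trace term controls [x] from
    above. *)
Lemma rvalue_coercive (Phi : R -> 'M[C]_m) : admissible_psd n Rk Phi ->
  exists nu K K' : R, 0 < nu /\ forall p Q x y, Po n p -> Pm n Q ->
   (intlog p Q <= x%:E)%E -> 0 <= y ->
   nu * coef_norm n Q + lam * (w * y) <= rvalue x y p Q (penalty_min n eps Q) + K /\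
   A * (w * x) <= rvalue x y p Q (penalty_min n eps Q) + K'.
Proof.
move=> hPhi; have [nu nu0 hnu] := trace_pairing_coercive hPhi.
pose B : R := (1 + 2 * n)%:R.
(* Half of the coercivity constant pays for the logarithm in [integrand_lower]; the other half
   remains. *)
have [||K hK] := @ln_le_linear (B * m%:R) (nu / 2); [by rewrite mulr_ge0|by rewrite divr_gt0|].
pose P0 := \sum_(j < m) \sum_(h < m | (h <= j)%N)
    (weight R n j h - weight R n j h * ln (weight R n j h / eps)).
pose c0 := \sum_(0 <= k < n.+1) 2 * `|c k|.
exists (A * (nu / 2)), (A * (m%:R * (1 + B) + K + c0) - kappa - P0),
  (A * c0 - kappa - P0).
split; first by rewrite mulr_gt0// divr_gt0.
move=> p Q x y pP QP xI y0; rewrite /rvalue.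
have h1 : - integrand_lower n Q <= w * x.
  have := le_trans (intlog_lower pP QP) xI; rewrite lee_fin.
  by rewrite -(ler_pM2l w_gt0) mulrCA mulVf ?mulr1// gt_eqF ?pi2_gt0.
have h2 := hnu Q QP.
have h3 := hK _ (coef_norm_ge0 n Q).
have h4 : \sum_(0 <= k < n.+1) p k * c k <= c0.
  rewrite /c0 big_nat_cond [leRHS]big_nat_cond; apply: ler_sum => k /andP[/andP[_ kn] _].
  apply: (le_trans (ler_norm _)); rewrite normrM ler_wpM2r//.
  exact: nonneg_peval_coef_le pP.1 pP.2 _ _.
have h5 := penalty_min_bounded n eps0 Q.
have h6 : 0 <= A * (w * x + trace_pairing n Rk Q - (\sum_(0 <= k < n.+1) p k * c k)
   - (nu / 2 * coef_norm n Q - (m%:R * (1 + B) + K + c0))).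
  apply: mulr_ge0; first exact: ltW.
  move: h1; rewrite /integrand_lower -/B mulrA; move: h2 h3 h4.
  move: (\sum_(0 <= k < n.+1) _) (trace_pairing _ _ _) (coef_norm _ _) (ln _).
  move: (m%:R * (1 + B)) (B * m%:R) => u v s1 s2 s3 s4.
  move: (v * s4) => v'; lra.
have h7 : 0 <= A * (trace_pairing n Rk Q - (\sum_(0 <= k < n.+1) p k * c k) + c0).
  apply: mulr_ge0; first exact: ltW.
  have := mulr_ge0 (ltW nu0) (coef_norm_ge0 n Q).
  move: h2 h4; move: (\sum_(0 <= k < n.+1) _) (trace_pairing _ _ _) (nu * _).
  move=> s1 s2 s3; lra.
have h8 : 0 <= lam * (w * y) by rewrite !mulr_ge0// ltW.
move: h5 h6 h7 h8; rewrite -/P0.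
move: (\sum_(0 <= k < n.+1) _) (trace_pairing _ _ _) (coef_norm _ _) (penalty_min _ _ _).
by move=> s1 s2 s3 s4; split; lra.
Qed.

Lemma zero_Pm : Pm n (fun=> 0 : 'M[R]_m).
Proof.
split; first by rewrite trmx0.
pose Z : nat -> 'M[R]_m := fun=> 0.
have Z0 k a b : Z k a b = 0 by rewrite mxE.
move=> t; have -> : Qeval n (fun=> 0 : 'M[R]_m) t = 0.
  apply/matrixP => a b; apply: etrans (QevalE n Z t a b) _.
  rewrite Z0 [RHS]mxE big1 ?mulr0 ?addr0// => k _.
  by rewrite !Z0 !mulr0 addr0.
split; first by move=> a b; rewrite !mxE; exact/esym/rmorph0.
by move=> x; rewrite mulmx0 mul0mx mxE.
Qed.

Lemma one_Bo : Bo n (fun k => (k == 0%N)%:R : R).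
Proof.
split=> // t; rewrite /peval big_nat_cond big1 ?addr0// => k /andP[/andP[k0 _] _].
by rewrite gtn_eqF// mul0r.
Qed.


(** * The objective at a limit of interior points *)

Section limit_point.
Variables (ps : nat -> nat -> R) (Qs : nat -> nat -> 'M[R]_m).
Variables (xs ys : nat -> R) (p : nat -> R) (Q : nat -> 'M[R]_m) (x y K : R).
Hypothesis psB : forall j, Bo n (ps j).
Hypothesis QsB : forall j, Bm n (Qs j).
Hypothesis xsE : forall j, intlog (ps j) (Qs j) = (xs j)%:E.
Hypothesis ysE : forall j, intinv (ps j) = (ys j)%:E.
Hypothesis psp : forall k, (k <= n)%N -> (fun j => ps j k) @ \oo --> p k.
Hypothesis QsQ : forall k a b, (k <= n)%N -> (fun j => Qs j k a b) @ \oo --> Q k a b.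
Hypothesis xsx : xs @ \oo --> x.
Hypothesis ysy : ys @ \oo --> y.
Hypothesis K0 : 0 <= K.
Hypothesis KQ : forall j, integrand_lower n (Qs j) <= K.

Let pP : Po n p. Proof. exact: cvg_Po (fun j => Bo_Po (psB j)) psp. Qed.
Let QP : Pm n Q. Proof. exact: cvg_Pm (fun j => Bm_Pm (QsB j)) QsQ. Qed.

Lemma limit_intinv : (intinv p <= y%:E)%E.
Proof.
apply: (@fatou_Tset R (fun j t => (peval n (ps j) t)^-1) _ 0 ys) => //.
- by move=> j; apply: measurable_inv_peval; exact: Bo_Po.
- exact: measurable_inv_peval.
- by move=> j t _; rewrite oppr0 invr_ge0 ltW// (psB j).2.
- by move=> t _; rewrite oppr0 invr_ge0 pP.2.
move=> t _ e e0.
(* At a zero of [p] the inverse is the default 0, so the bound is trivial there. *)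
have := pP.2 t; rewrite le_eqVlt => /orP[/eqP pt|pt].
  apply: nearW => j; rewrite -pt invr0 sub0r.
  apply: (@le_trans _ _ 0); first by rewrite oppr_le0 ltW.
  by rewrite invr_ge0 ltW// (psB j).2.
have cv : (fun j => (peval n (ps j) t)^-1) @ \oo --> (peval n p t)^-1.
  by apply: cvgV; [rewrite gt_eqF|exact: cvg_peval psp].
by move: cv => /cvgr_ge; apply; rewrite ltrBlDr ltrDl.
Qed.

Lemma limit_Bo : Bo n p.
Proof.
apply: contrapT => nB; have := limit_intinv.
by rewrite /intinv (integral_inv_boundary pP nB) leye_eq.
Qed.

Let integrands_ge j t : - K <= integrand n (ps j) (Qs j) t.
Proof.
apply: le_trans (integrand_ge (Bo_Po (psB j)) ((Bm_Pm (QsB j)).2 t)).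
by rewrite lerN2 KQ.
Qed.

Let measurable_integrands j : measurable_fun T (integrand n (ps j) (Qs j)).
Proof. by apply: measurable_integrand; [exact: Bo_Po|exact: Bm_Pm]. Qed.

(** If [det Q] vanished identically, the integrands would eventually exceed any constant at every
    angle, as [p > 0]. Fatou's lemma with the constant [(|x| + 1) / (2 pi)] would give
    [|x| + 1 <= x]. *)
Lemma limit_det : ~ (forall t, \det (Qeval n Q t) = 0).
Proof.
move=> D0; pose M := (`|x| + 1) * w.
have M0 : 0 <= M by rewrite mulr_ge0 ?addr_ge0// ltW.
have : (\int[mu]_(t in T) M%:E <= x%:E)%E.
  apply: (@fatou_Tset R (fun j => integrand n (ps j) (Qs j)) (fun=> M) K xs) => //.
    by move=> t _; apply: le_trans M0; rewrite oppr_le0.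
  move=> t _ e e0.
  have Dt : complex.Re (\det (Qeval n Q t)) = 0 := congr1 (@complex.Re R) (D0 t).
  exact: (integrand_diverges psB QsB psp QsQ (limit_Bo.2 t) Dt (M - e)).
rewrite integral_Tset_cst lee_fin /M -mulrA mulVf ?gt_eqF ?pi2_gt0// mulr1.
by have := ler_norm x; lra.
Qed.

Lemma limit_intlog : (intlog p Q <= x%:E)%E.
Proof.
pose K2 := K + integrand_lower n Q.
have l0 := integrand_lower_ge0 n Q.
apply: (@fatou_Tset R (fun j => integrand n (ps j) (Qs j)) _ K2 xs) => //.
- by rewrite addr_ge0.
- exact: measurable_integrand.
- by move=> j t _; apply: le_trans (integrands_ge j t); rewrite lerN2 lerDl.
- by move=> t _; apply: le_trans (integrand_ge pP (QP.2 t)); rewrite lerN2 lerDr.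
move=> t _ e e0.
(* At a singular angle the integrands tend to +oo, so they eventually exceed the finite default
   value of the limit integrand. *)
have := detQ_ge0 (QP.2 t); rewrite le_eqVlt => /orP[/eqP/esym Dt|Dt].
  exact: (integrand_diverges psB QsB psp QsQ (limit_Bo.2 t) Dt).
have := cvg_integrand psB QsB psp QsQ (limit_Bo.2 t) Dt.
by move=> /cvgr_ge; apply; rewrite ltrBlDr ltrDl.
Qed.
End limit_point.

Lemma ell_min_exists (Phi : R -> 'M[C]_m) : admissible_psd n Rk Phi ->
  exists p Q, [/\ Bo n p, Bm_closure n Q &
    forall p' Q' gam', Bo n p' -> Bm n Q' ->
      (forall j h : 'I_m, (h <= j)%N -> 0 < gam' j h) ->
      (ell n N Rk c kappa lam eps p Q alpha (gam_opt n eps Q) <=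
       ell n N Rk c kappa lam eps p' Q' alpha gam')%E].
Proof.
move=> hPhi; have [nu [K [K' [nu0 co]]]] := rvalue_coercive hPhi.
pose X p Q := fine (intlog p Q); pose Y p := fine (intinv p).
pose E p Q := rvalue (X p Q) (Y p) p Q (penalty_min n eps Q).
have XE p Q : Bo n p -> Bm n Q -> intlog p Q = (X p Q)%:E.
  by move=> pB QB; rewrite /X fineK// intlog_fin.
have YE p : Bo n p -> intinv p = (Y p)%:E by move=> pB; rewrite /Y fineK// intinv_fin.
have Y0 p : Bo n p -> 0 <= Y p.
  by move=> pB; rewrite /Y fine_ge0// intinv_ge0//; exact: Bo_Po.
have coE p Q (pB : Bo n p) (QB : Bm n Q) :
    nu * coef_norm n Q + lam * (w * Y p) <= E p Q + K /\ A * (w * X p Q) <= E p Q + K'.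
  by apply: co; [exact: Bo_Po|exact: Bm_Pm|rewrite XE|exact: Y0].
have nnY p (pB : Bo n p) : 0 <= lam * (w * Y p).
  by rewrite mulr_ge0 ?(ltW lam0)// mulr_ge0 ?(ltW w_gt0)// Y0.
have nnC Q : 0 <= nu * coef_norm n Q by rewrite mulr_ge0 ?(ltW nu0)// coef_norm_ge0.
pose S := [set e | exists p Q, [/\ Bo n p, Bm n Q & e = E p Q]].
have hS : has_inf S.
  split.
    (* The interior point [p = 1], [Q = I]. *)
    exists (E (fun k => (k == 0%N)%:R) (shift (fun=> 0) 1)).
    do 2 eexists; split; last reflexivity; first exact: one_Bo.
    by apply: shift_Bm => //; exact: zero_Pm.
  exists (- K) => _ [p [Q [pB QB ->]]].
  by have [h _] := coE p Q pB QB; have := nnY p pB; have := nnC Q; move: h; lra.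
pose I0 := inf S.
have /choice [pq pqP] : forall j : nat, exists pq : (nat -> R) * (nat -> 'M[R]_m),
    [/\ Bo n pq.1, Bm n pq.2 & E pq.1 pq.2 < I0 + j.+1%:R^-1].
  move=> j; have [|e [p [Q [pB QB ->]]] eI] := @inf_adherent R S j.+1%:R^-1 _ hS.
    by rewrite invr_gt0.
  by exists (p, Q).
pose ps j := (pq j).1; pose Qs j := (pq j).2.
have psB j : Bo n (ps j) by have [] := pqP j.
have QsB j : Bm n (Qs j) by have [] := pqP j.
have EI j : E (ps j) (Qs j) < I0 + j.+1%:R^-1 by have [] := pqP j.
have EI1 j : E (ps j) (Qs j) <= I0 + 1.
  by apply: (le_trans (ltW (EI j))); rewrite lerD2l invf_le1 ?ltr0n// ler1n.
pose CN := (I0 + 1 + K) / nu.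
have Cb j : coef_norm n (Qs j) <= CN.
  rewrite /CN ler_pdivlMr// mulrC; have [h _] := coE _ _ (psB j) (QsB j).
  by have := EI1 j; have := nnY _ (psB j); move: h; lra.
have CN0 : 0 <= CN by apply: le_trans (Cb 0%N); exact: coef_norm_ge0.
pose B : R := (1 + 2 * n)%:R.
pose KK := m%:R * (1 + B) + B * (m%:R * ln (1 + CN)).
have KQ j : integrand_lower n (Qs j) <= KK.
  rewrite /integrand_lower lerD2l ler_wpM2l// ler_wpM2l//.
  by rewrite ler_ln ?posrE ?ltr_pwDl ?coef_norm_ge0// lerD2l.
have KK0 : 0 <= KK by apply: le_trans (KQ 0%N); exact: integrand_lower_ge0.
(* The two integrals are extracted together with the coefficients, so that along one subsequence the
   whole objective converges. *)
pose J : finType := ('I_n.+1 + 'I_n.+1 * 'I_m * 'I_m + bool)%type.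
pose u (i : J) j : R := match i with
  | inl (inl k) => ps j k
  | inl (inr (k, a, b)) => Qs j k a b
  | inr true => X (ps j) (Qs j)
  | inr false => Y (ps j) end.
have [|f fm fc] := @bolzano_weierstrass_seq R J (enum J) u.
  move=> [[k|[[k a] b]]|[]] _.
  - exists 2 => j; apply: nonneg_peval_coef_le (psB j).1 _ _ _; last by rewrite -ltnS.
    by move=> t; exact: ltW ((psB j).2 t).
  - exists CN => j; apply: le_trans (Cb j); apply: le_coef_norm; first by rewrite -ltnS.
  - exists (KK * (2 * pi) + `|(I0 + 1 + K') / (A * w)|) => j.
    have lo : - (KK * (2 * pi)) <= X (ps j) (Qs j).
      have := intlog_lower (Bo_Po (psB j)) (Bm_Pm (QsB j)); rewrite XE// lee_fin.
      by apply: le_trans; rewrite mulNr lerN2 ler_pM2r ?pi2_gt0.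
    have hi : X (ps j) (Qs j) <= (I0 + 1 + K') / (A * w).
      have Aw : 0 < A * w := mulr_gt0 A_gt0 w_gt0.
      rewrite (ler_pdivlMr _ _ Aw) (mulrC (X _ _)) -mulrA; have [_ h] := coE _ _ (psB j) (QsB j).
      by apply: (le_trans h); rewrite lerD2r.
    have h1 := ler_norm ((I0 + 1 + K') / (A * w)).
    have h2 : 0 <= KK * (2 * pi) by rewrite mulr_ge0 ?(ltW (pi2_gt0 R)).
    have -> : u (inr true) j = X (ps j) (Qs j) by [].
    rewrite ler_norml; move: lo hi h1 h2 (normr_ge0 ((I0 + 1 + K') / (A * w))).
    move: (_ / _) (KK * _) (X _ _) => v1 v2 v3 a1 a2 a3 a4 a5; apply/andP; split; lra.
  - exists ((I0 + 1 + K) / (lam * w)) => j; rewrite ger0_norm ?Y0//.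
    have lw : 0 < lam * w := mulr_gt0 lam0 w_gt0.
    rewrite (ler_pdivlMr _ _ lw) (mulrC (Y _)) -mulrA; have [h _] := coE _ _ (psB j) (QsB j).
    by have := EI1 j; have := nnC (Qs j); move: h; lra.
pose p k := limn (fun j => ps (f j) k).
pose Q k : 'M[R]_m := \matrix_(a, b) limn (fun j => Qs (f j) k a b).
have cu i : cvgn (u i \o f) by apply: fc; rewrite mem_enum.
have psp k : (k <= n)%N -> (fun j => ps (f j) k) @ \oo --> p k.
  by move=> kn; exact: (cu (inl (inl (Ordinal (kn : (k < n.+1)%N))))).
have QsQ k a b : (k <= n)%N -> (fun j => Qs (f j) k a b) @ \oo --> Q k a b.
  by move=> kn; rewrite mxE; exact: (cu (inl (inr (Ordinal (kn : (k < n.+1)%N), a, b)))).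
pose x := limn (fun j => X (ps (f j)) (Qs (f j))).
pose y := limn (fun j => Y (ps (f j))).
have xsx : (fun j => X (ps (f j)) (Qs (f j))) @ \oo --> x := cu (inr true).
have ysy : (fun j => Y (ps (f j))) @ \oo --> y := cu (inr false).
have psB' j : Bo n (ps (f j)) := psB (f j).
have QsB' j : Bm n (Qs (f j)) := QsB (f j).
have xsE j := XE _ _ (psB' j) (QsB' j).
have ysE j := YE _ (psB' j).
have KQ' j := KQ (f j).
have pB : Bo n p := limit_Bo psB' ysE psp ysy.
have Iinv : (intinv p <= y%:E)%E := limit_intinv psB' ysE psp ysy.
have dQ := limit_det psB' QsB' xsE ysE psp QsQ xsx ysy KK0 KQ'.
have Ilog := limit_intlog psB' QsB' xsE ysE psp QsQ xsx ysy KK0 KQ'.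
exists p, Q; split => //.
  split=> //; exists (fun j => Qs (f j)); split => // k kn a b; exact: QsQ.
have le1 : (ell n N Rk c kappa lam eps p Q alpha (gam_opt n eps Q) <= I0%:E)%E.
  (* Fatou's lemma only bounds the integrals at the limit point by [x] and [y]. The real expression
     in [x] and [y], however, is an exact limit of values below [I0 + 1 / (j + 1)]. *)
  rewrite ellE; apply: le_trans (evalue_le p Q _ Ilog Iinv) _.
  rewrite evalue_fin penalty_opt// lee_fin -subr_ge0.
  have cE : (fun j => E (ps (f j)) (Qs (f j))) @ \oo --> rvalue x y p Q (penalty_min n eps Q).
    rewrite /E /rvalue; apply: cvgD; last exact: cvg_penalty_min.
    apply: cvgD; last by apply: cvgM; [exact: cvg_cst|apply: cvgM; [exact: cvg_cst|exact: ysy]].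
    apply: cvgD; last exact: cvg_cst.
    apply: cvgM; first exact: cvg_cst.
    apply: cvgB.
      apply: cvgD; first by apply: cvgM; [exact: cvg_cst|exact: xsx].
      rewrite trace_pairingE; under eq_fun do rewrite trace_pairingE.
      apply: cvg_sum_seq => k _; apply: cvg_sum_seq => a _; apply: cvg_sum_seq => b _.
      by apply: cvgM; [apply: QsQ; rewrite -ltnS|exact: cvg_cst].
    apply: cvg_sum_seq => k; rewrite mem_index_iota => /andP[_ kn].
    by apply: cvgM; [exact: psp|exact: cvg_cst].
  have cI : (fun j => I0 + j.+1%:R^-1 - E (ps (f j)) (Qs (f j))) @ \oo -->
      I0 + 0 - rvalue x y p Q (penalty_min n eps Q).
    apply: cvgB cE; apply: cvgD; [exact: cvg_cst|exact: cvg_harmonic].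
  rewrite -[I0]addr0; apply: cvg_ge0 cI _ => j; rewrite subr_ge0.
  apply: (le_trans (ltW (EI (f j)))); rewrite lerD2l lef_pV2 ?posrE// ler_nat ltnS.
  exact: mono_nat_ge.
move=> p' Q' gam' pB' QB' g0; apply: le_trans le1 _.
rewrite ellE XE// YE// evalue_fin lee_fin.
apply: (@le_trans _ _ (E p' Q')).
  by apply: ge_inf; [exact: hS.2|exists p', Q'].
by rewrite /E /rvalue lerD2l penalty_min_le.
Qed.

End objective.

(** * Passage from interior points to the closures *)

Section closure_facts.
Variable R : realType.
Variables m n : nat.

Lemma Bo_closure_Po (p : nat -> R) : Bo_closure n p -> Po n p.
Proof. by move=> [s [sB sp]]; apply: cvg_Po sp => j; exact: Bo_Po. Qed.

Lemma Bm_closure_Pm (Q : nat -> 'M[R]_m) : Bm_closure n Q -> Pm n Q.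
Proof.
move=> [[s [sB sQ]] _]; apply: (@cvg_Pm _ _ _ s) => [j|k a b kn]; first exact: Bm_Pm.
exact: sQ.
Qed.

Lemma Bo_in_closure (p : nat -> R) : Bo n p -> Bo_closure n p.
Proof. by move=> pB; exists (fun=> p); split => // k _; exact: cvg_cst. Qed.

Lemma Bm_in_closure (Q : nat -> 'M[R]_m) : Bm n Q -> Bm_closure n Q.
Proof.
move=> QB; split; first by exists (fun=> Q); split => // k _ a b; exact: cvg_cst.
move=> D0; have := posdef_det (QB.2 0); rewrite (D0 0); exact/negP/negbT/ltxx.
Qed.
End closure_facts.

Unset Implicit Arguments.

Theorem theorem2 (R : realType) (m n N : nat) (Rk : nat -> 'M[R]_m) (c : nat -> R)
    (alpha lam eps kappa : R) :
  (0 < m)%N -> (0 < n)%N -> (0 < N)%N ->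
  0 < alpha -> 0 < lam -> 0 < eps ->
  (Rk 0%N)^T = Rk 0%N ->
  (exists Phi : R -> 'M[R[i]]_m, admissible_psd n Rk Phi) ->
  (exists (p : nat -> R) (Q : nat -> 'M[R]_m) (gam : 'I_m -> 'I_m -> R),
     feasible n p Q gam /\
     forall p' Q' gam', feasible n p' Q' gam' ->
       (ell n N Rk c kappa lam eps p Q alpha gam <= ell n N Rk c kappa lam eps p' Q' alpha gam')%E)
  /\
  (forall (p : nat -> R) (Q : nat -> 'M[R]_m) (gam : 'I_m -> 'I_m -> R),
     feasible n p Q gam ->
     (forall p' Q' gam', feasible n p' Q' gam' ->
       (ell n N Rk c kappa lam eps p Q alpha gam <= ell n N Rk c kappa lam eps p' Q' alpha gam')%E) ->
     Bo n p /\ Bm n Q).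
Proof.
move=> _ _ N0 alpha0 lam0 eps0 _ [Phi hPhi].
have [p0 [Q0 [pB0 QB0 min0]]] :=
  @ell_min_exists R m n N Rk c alpha lam eps kappa N0 alpha0 lam0 eps0 Phi hPhi.
split.
  exists p0, Q0, (gam_opt n eps Q0); split.
    split; first exact: Bo_in_closure.
    by split => // j h _; exact: gam_opt_gt0.
  move=> p Q gam [pC [QC g0]].
  have pP := Bo_closure_Po pC; have QP := Bm_closure_Pm QC.
  have [pB|pB] := pselect (Bo n p); last by rewrite (ell_boundary_p _ _ _ _ N0 alpha0 lam0 _ pP pB QP) leey.
  have [QB|QB] := pselect (Bm n Q); first exact: min0.
  (* The shift that beats a singular [Q] is interior, so [min0] applies to it. *)
  have [s [s0 /ltW le_s]] := ell_boundary_Q Rk c eps kappa N0 alpha0 lam0 pB QP QC.2 QB g0.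
  by apply: le_trans le_s; apply: min0 => //; exact: shift_Bm.
move=> p Q gam [pC [QC g0]] minp.
have pP := Bo_closure_Po pC; have QP := Bm_closure_Pm QC.
have pB : Bo n p.
  apply: contrapT => nB.
  (* A competitor of finite value with the same [gam], which rules out a minimizer of value +oo. *)
  have fe : feasible n (fun k => (k == 0%N)%:R) (shift (fun=> 0) 1) gam.
    split; first by apply: Bo_in_closure; exact: one_Bo.
    exact (conj (Bm_in_closure (shift_Bm (zero_Pm R m n) ltr01)) g0).
  have := minp _ _ _ fe; rewrite (ell_boundary_p _ _ _ _ N0 alpha0 lam0 _ pP nB QP) leye_eq.
  rewrite ellE -(fineK (intlog_fin (one_Bo R n) (shift_Bm (zero_Pm R m n) ltr01))).
  by rewrite -(fineK (intinv_fin (one_Bo R n))) evalue_fin.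
split => //; apply: contrapT => nB.
have [s [s0 lt_s]] := ell_boundary_Q Rk c eps kappa N0 alpha0 lam0 pB QP QC.2 nB g0.
have fe : feasible n p (shift Q s) gam.
  exact (conj pC (conj (Bm_in_closure (shift_Bm QP s0)) g0)).
by have := minp _ _ _ fe; rewrite leNgt lt_s.
Qed.
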